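(* Suppose $k\lesssim\frac n{\log p}$ and $\widehat\beta^L$ is the Lasso estimator defined in the context with $A>\sqrt2$. Let $0<\alpha<1$ and $$\mathrm{CI}^1_\alpha(Z)=\left[\Big(\frac{\psi(Z)}{\frac1{n_2}\chi^2_{1-\alpha/2}(n_2)}-\sigma_0^2\Big)_+,\ \Big(\frac{\psi(Z)}{\frac1{n_2}\chi^2_{\alpha/2}(n_2)}-\sigma_0^2\Big)_+\right],\qquad \psi(Z)=\min\Big\{\frac1{n_2}\big\|y^{(2)}-X^{(2)}\widehat\beta^L\big\|_2^2,\ \sigma_0^2\log p\Big\}.$$ Then $$\liminf_{n,p\to\infty}\ \inf_{\theta\in\Theta_0(k)}\mathbb P_\theta\big(\|\widehat\beta^L-\beta\|_2^2\in\mathrm{CI}^1_\alpha(Z)\big)\ge1-\alpha$$ and $$\sup_{\theta\in\Theta_0(k)}\mathbf E_\theta\,\mathbf L\big(\mathrm{CI}^1_\alpha(Z)\big)\lesssim\frac1{\sqrt n}\sigma_0^2 .$$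
   Context: Model: one observes $Z=(X,y)$ with $y=X\beta+\epsilon$, $X\in\mathbb R^{n\times p}$ with i.i.d. rows $X_{i\cdot}\sim N_p(0,\Sigma)$, $\epsilon\sim N_n(0,\sigma^2\mathrm I)$ independent of $X$. The parameter is $\theta=(\beta,\Sigma,\sigma)$; $\mathbb P_\theta,\mathbf E_\theta$ are probability and expectation under $\theta$, and $\beta$ in the coverage statement is the first component of $\theta$. $\Theta_0(k)=\{(\beta,\mathrm I,\sigma_0):\|\beta\|_0\le k\}$, where $\sigma_0>0$ is the known noise level and $\|\beta\|_0$ is the number of nonzero coordinates. $a_+=\max\{a,0\}$; $\chi^2_\tau(m)$ is the $\tau$-quantile of the $\chi^2$ distribution with $m$ degrees of freedom; $\mathbf L$ of an interval is its length. For positive sequences, $a_n\lesssim b_n$ means $a_n\le Cb_n$ for all $n$, with $C$ a generic positive constant, and $a_n\asymp b_n$ means $a_n\lesssim b_n$ and $b_n\lesssim a_n$. Lasso: $Z$ is randomly split into subsamples $Z^{(1)}=(y^{(1)},X^{(1)})$ and $Z^{(2)}=(y^{(2)},X^{(2)})$ of sizes $n_1$ and $n_2$ with $n_1\asymp n_2$, and $$\widehat\beta^L=\arg\min_{\beta\in\mathbb R^p}\frac{\|y^{(1)}-X^{(1)}\beta\|_2^2}{n_1}+\lambda\sum_{j=1}^p\frac{\|X^{(1)}_{\cdot j}\|_2}{\sqrt{n_1}}|\beta_j|,\qquad \lambda=A\sqrt{\tfrac{\log p}{n_1}}\,\sigma_0,$$ where $X^{(1)}_{\cdot j}$ is the $j$-th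 column of $X^{(1)}$ and $A$ is a pre-specified constant.
   Formalization: The condition k ≲ n/log p is taken as k ≤ c n/log p with a sufficiently small constant c > 0 depending only on the constant in n₁ ≍ n₂; for arbitrary large constants (e.g. p = n²) the Lasso can fail and the coverage claim is false. *)

(* Defs.v *)
From HB Require Import structures.
From mathcomp Require Import all_boot all_order all_algebra all_fingroup.
From mathcomp Require Import all_classical all_reals all_analysis.
Set Implicit Arguments.
Unset Strict Implicit.
Unset Printing Implicit Defensive.
Import Order.TTheory GRing.Theory Num.Theory.
Import numFieldNormedType.Exports.
Local Open Scope classical_set_scope.
Local Open Scope ring_scope.

Section independence.
Context d (T : measurableType d) (R : realType) (P : probability T R).

Definition indep2 (F G : set_system T) : Prop :=
  forall A B, F A -> G B -> P (A `&` B) = (P A * P B)%E.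

Definition mutual_indep (I : finType) (F : I -> set_system T) : Prop :=
  forall (J : {set I}) (A : I -> set T), (forall i, i \in J -> F i (A i)) ->
    P (\bigcap_(i in [set` J]) A i) = (\prod_(i in J) fine (P (A i)))%:E.

End independence.

(* sigma-algebra on T generated by a family of real functions; T carries no
   measurable structure, so this also provides the Borel sigma-algebra of a
   space of matrices, generated by the entries *)
Definition sigma_of (R : realType) (T I : Type) (f : I -> T -> R) :
    set_system T :=
  <<s \bigcup_i preimage_set_system setT (f i) measurable >>.

Section vectors.
Context (R : realType).

(* the library norm on matrices is the sup norm *)
Definition sqnorm n (v : 'cV[R]_n) : R := \sum_i v i 0 ^+ 2.

Definition l2norm n (v : 'cV[R]_n) : R := Num.sqrt (sqnorm v).

Definition l0norm n (v : 'cV[R]_n) : nat := #|[set i | v i 0 != 0]%SET|.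

Definition posdef n (L : 'M[R]_n) : Prop :=
  L^T = L /\ forall v : 'cV[R]_n, v != 0 -> 0 < (v^T *m L *m v) 0 0.

End vectors.

Section gaussian.
Context d (T : measurableType d) (R : realType) (P : probability T R).

Definition std_gaussian n (g : T -> 'cV[R]_n) : Prop :=
  [/\ forall i, measurable_fun setT (fun t => g t i 0),
      mutual_indep P (fun i => sigma_of (fun (_ : unit) t => g t i 0)) &
      forall i (B : set R), measurable B ->
        P ((fun t => g t i 0) @^-1` B) = normal_prob 0 1 B].

(* x ~ N_n(0, Sigma) for a positive definite Sigma: x = Sigma^(1/2) g with g
   standard Gaussian. As Sigma^(1/2) is invertible, g is determined by x, so
   that taking g on the same probability space loses no generality. *)
Definition mvnormal n (Sigma : 'M[R]_n) (x : T -> 'cV[R]_n) : Prop :=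
  exists (L : 'M[R]_n) (g : T -> 'cV[R]_n),
    [/\ posdef L, L *m L = Sigma, std_gaussian g & forall t, x t = L *m g t].

End gaussian.

(* law of the sum of squares of m independent N(0, 1) variables, by iterated
   convolution *)
Fixpoint chi2_prob (R : realType) (m : nat) (B : set R) : \bar R :=
  if m is m'.+1 then
    (\int[normal_prob (0 : R)%R 1%R]_g
      chi2_prob m' [set v : R | B (v + (g : R) ^+ 2)%R])%E
  else dirac (0 : R) B.

Definition chi2_quantile (R : realType) (tau : R) (m : nat) : R :=
  inf [set q : R | (tau%:E <= chi2_prob m `]-oo, q])%E].

Section model.
Context (R : realType).

Record param (p : nat) := Param {
  coef : 'cV[R]_p ;
  covar : 'M[R]_p ;
  noise : R }.

Definition Theta0 p (sigma0 : R) (k : nat) : set (param p) :=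
  [set th | [/\ (l0norm (coef th) <= k)%N, covar th = 1%:M &
                noise th = sigma0]].

(* the data (X, y) *)
Definition sample (n p : nat) : Type := ('M[R]_(n, p) * 'cV[R]_n)%type.

Definition entry n p (c : 'I_n * 'I_p + 'I_n) (z : sample n p) : R :=
  match c with
  | inl ij => z.1 ij.1 ij.2
  | inr i => z.2 i 0
  end.

Definition residual n p (z : sample n p) (b : 'cV[R]_p) : 'cV[R]_n :=
  z.2 - z.1 *m b.

Definition linear_model d (T : measurableType d) (P : probability T R) n p
    (th : param p) (Z : T -> sample n p) : Prop :=
  let eps t := residual (Z t) (coef th) in
  [/\ forall c, measurable_fun setT (fun t => entry c (Z t)),
      mutual_indep P (fun i : 'I_n => sigma_of (fun j t => (Z t).1 i j)),
      forall i, mvnormal P (covar th) (fun t => (row i (Z t).1)^T),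
      mvnormal P ((noise th ^+ 2)%:M) eps &
      indep2 P
        (sigma_of (fun (ij : 'I_n * 'I_p) t => (Z t).1 ij.1 ij.2))
        (sigma_of (fun i t => eps t i 0))].

(* A random split is a uniform permutation of the observations, independent of
   the data; the first n1 permuted observations form the first subsample. *)
Definition random_split d (T : measurableType d) (P : probability T R) n p
    (Z : T -> sample n p) (s : T -> 'S_n) : Prop :=
  forall sg : 'S_n,
    [/\ measurable (s @^-1` [set sg]),
        P (s @^-1` [set sg]) = ((n`!)%:R^-1)%:E &
        indep2 P [set s @^-1` [set sg]] (sigma_of (fun c t => entry c (Z t)))].

Definition subsample1 n1 n2 p (s : 'S_(n1 + n2)) (z : sample (n1 + n2) p) :
    sample n1 p :=
  (usubmx (row_perm s z.1), usubmx (row_perm s z.2)).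

Definition subsample2 n1 n2 p (s : 'S_(n1 + n2)) (z : sample (n1 + n2) p) :
    sample n2 p :=
  (dsubmx (row_perm s z.1), dsubmx (row_perm s z.2)).

Definition lasso_lambda (A sigma0 : R) (n p : nat) : R :=
  A * Num.sqrt (ln p%:R / n%:R) * sigma0.

Definition lasso_objective (lambda : R) n p (z : sample n p) (b : 'cV[R]_p) :
    R :=
  sqnorm (residual z b) / n%:R +
  lambda * \sum_j l2norm (col j z.1) / Num.sqrt n%:R * `|b j 0|.

(* A Lasso estimator is a Borel map selecting a minimizer for every sample:
   the minimizer need not be unique. *)
Definition lasso_estimator (A sigma0 : R) n p
    (bhat : sample n p -> 'cV[R]_p) : Prop :=
  (forall z b, lasso_objective (lasso_lambda A sigma0 n p) z (bhat z) <=
               lasso_objective (lasso_lambda A sigma0 n p) z b) /\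
  (forall j (B : set R), measurable B ->
     sigma_of (@entry n p) ((fun z => bhat z j 0) @^-1` B)).

Section interval.
Context (n1 n2 p : nat) (sigma0 alpha : R) (bhat : sample n1 p -> 'cV[R]_p).

Definition psi (s : 'S_(n1 + n2)) (z : sample (n1 + n2) p) : R :=
  Num.min
    (sqnorm (residual (subsample2 s z) (bhat (subsample1 s z))) / n2%:R)
    (sigma0 ^+ 2 * ln p%:R).

Definition CI_bound (tau : R) (s : 'S_(n1 + n2)) (z : sample (n1 + n2) p) : R :=
  Num.max (psi s z / (n2%:R^-1 * chi2_quantile tau n2) - sigma0 ^+ 2) 0.

Definition CI1 (s : 'S_(n1 + n2)) (z : sample (n1 + n2) p) : interval R :=
  `[CI_bound (1 - alpha / 2) s z, CI_bound (alpha / 2) s z].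

Context d (T : measurableType d) (P : param p -> probability T R)
  (Z : T -> sample (n1 + n2) p) (s : T -> 'S_(n1 + n2)).

Definition coverage (th : param p) : \bar R :=
  P th [set t | sqnorm (bhat (subsample1 (s t) (Z t)) - coef th)
                  \in CI1 (s t) (Z t)].

Definition expected_length (th : param p) : \bar R :=
  (\int[P th]_t lebesgue_measure [set` CI1 (s t) (Z t)])%E.

End interval.
End model.

(* Main.v *)
Require Import Defs.
From HB Require Import structures.
From mathcomp Require Import all_boot all_order all_algebra all_fingroup.
From mathcomp Require Import all_classical all_reals all_analysis.
From mathcomp Require Import measurable_realfun normal_distribution.
From mathcomp Require Import ring lra.
Set Implicit Arguments.
Unset Strict Implicit.
Unset Printing Implicit Defensive.
Import Order.TTheory GRing.Theory Num.Theory.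
Import numFieldNormedType.Exports.
Local Open Scope classical_set_scope.
Local Open Scope ring_scope.

(* Let h = bhat - beta.  Conditionally on the first subsample,
   RSS = |y2 - X2 bhat|^2 is (|h|^2 + sigma0^2) times a chi-squared
   variable with n2 degrees of freedom; hence the interval covers |h|^2 with
   probability at least 1 - alpha unless the truncation psi = sigma0^2 ln p is
   active, and its length is psi times O(1 / sqrt n2), because the chi-squared
   quantiles are within O(sqrt n2) of each other and at least n2 / B (Chernoff).
   Both claims thus follow from the bound E psi = O(sigma0^2), by Markov's
   inequality for the first one.

   That bound holds as soon as |h|^2 = O(sigma0^2) outside an event of
   probability O(1 / ln p), and this weak consistency does not need lambda to
   dominate the noise: lambda |bhat|_1 is controlled by |eps|^2 / n1 alone.  The
   basic inequality gives |h|_1 <= O(sigma0 sqrt (n1 / ln p) + sqrt k |h|), and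
   it remains to have, for all v,
     |X v|^2 >= (n1 / 16) |v|^2 - (4 n1 / M) |v|_1^2,    M ~ n1 / ln p.
   By Maurey's empirical method this follows from the lower bound
   |X u|^2 >= (n1 / 16) |u|^2 for the (2p)^M sums u of M signed unit vectors,
   to which a union bound applies. *)

(** * Gaussian integrals and the chi-squared law *)

(** The scales fit because lambda^2 = A^2 sigma0^2 ln p / n1. On the good event |eps|^2 / n1 <= 4
    sigma0^2, so the basic inequality bounds lambda |h|_1 by O(sigma0^2) + O(lambda sqrt k |h|).
    Squaring and dividing by A^2 sigma0^2 bounds (ln p / n1) |h|_1^2, which has exactly the order of
    the Maurey error |h|_1^2 / M, by O(sigma0^2) plus a multiple of (k ln p / n1) |h|^2. That
    multiple must be absorbed by |h|^2 / 16: hence the small constant in k <= c n / ln p, and the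
    factor 1024 * 2048. M is squeezed from both sides: M ln p <= n1 / 8 makes a union bound over
    (2p)^M events of probability exp(- n1 / 2) affordable, while 1 / M <= 16 ln p / n1 keeps the
    Maurey error at the scale above. Outside the good event psi is at most its cap sigma0^2 ln p,
    and a probability 1 / ln p turns this into sigma0^2. All estimates are proved for a fixed
    permutation, with constants that do not depend on it, and averaged over the split at the end. *)

Section density.
Local Open Scope ereal_scope.
Context d (T : measurableType d) (R : realType).
Variables (mu nu : {measure set T -> \bar R}) (f : T -> R).
Hypotheses (mf : measurable_fun setT f) (f0 : forall x, (0 <= f x)%R).
Hypothesis nuE : forall A, measurable A -> nu A = \int[mu]_(x in A) (f x)%:E.

Import HBNNSimple.

Let density_nnsfun (h : {nnsfun T >-> R}) :
  \int[nu]_x (h x)%:E = \int[mu]_x ((h x)%:E * (f x)%:E).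
Proof.
under [LHS]eq_integral do rewrite fimfunE -fsumEFin//.
rewrite [LHS]ge0_integral_fsum//; last 2 first.
  - by move=> r; exact/measurable_EFinP/measurableT_comp.
  - by move=> n x _; rewrite EFinM nnfun_muleindic_ge0.
under [RHS]eq_integral.
  move=> x xD; rewrite fimfunE -fsumEFin// muleC ge0_mule_fsumr; last first.
    by move=> r; rewrite EFinM nnfun_muleindic_ge0.
  over.
rewrite [RHS]ge0_integral_fsum//; last 2 first.
  - move=> r; apply: emeasurable_funM; first exact/measurable_EFinP.
    by apply/measurable_EFinP; do 2 apply/measurableT_comp => //.
  - move=> n x _; apply: mule_ge0; [by rewrite lee_fin|rewrite EFinM nnfun_muleindic_ge0//].
apply: eq_fsbigr => r _.
under [LHS]eq_integral do rewrite EFinM.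
rewrite integralZl_indic_nnsfun//= integral_indic//= setIT nuE//.
under [RHS]eq_integral do rewrite EFinM muleCA.
have [r0|r0] := ltP r 0%R.
  rewrite preimage_nnfun0// !integral_set0 mule0.
  by under eq_integral do rewrite indic0 mule0 mule0; rewrite integral0.
rewrite ge0_integralZl//; last 2 first.
  - apply: emeasurable_funM; first exact/measurable_EFinP.
    exact/measurable_EFinP/measurable_indic.
  - by move=> x _; rewrite mule_ge0// lee_fin.
congr (_ * _); rewrite integral_mkcond; apply: eq_integral => x _.
by rewrite patchE indicE; case: ifPn => _; rewrite ?mule1 ?mule0.
Qed.

Lemma ge0_integral_density (g : T -> \bar R) :
  measurable_fun setT g -> (forall x, 0 <= g x) ->
  \int[nu]_x g x = \int[mu]_x (g x * (f x)%:E).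
Proof.
move=> mg g0; pose g_ := nnsfun_approx measurableT mg.
transitivity (limn (fun n => \int[nu]_x (g_ n x)%:E)).
  rewrite -monotone_convergence//=.
  - apply: eq_integral => ? /[!inE] xD; apply/esym/cvg_lim => //=.
    exact: cvg_nnsfun_approx.
  - by move=> n; exact/measurable_EFinP/measurable_funTS.
  - by move=> n ? _; rewrite lee_fin.
  - by move=> ? _ ? ? mn; rewrite lee_fin; exact/lefP/nd_nnsfun_approx.
transitivity (limn (fun n => \int[mu]_x ((g_ n x)%:E * (f x)%:E))).
  by apply: congr_lim; apply/funext => n /=; exact: density_nnsfun.
rewrite -monotone_convergence//=.
- apply: eq_integral => x _; apply/cvg_lim => //=.
  under eq_fun do rewrite muleC; rewrite muleC.
  by apply: cvgeZl => //; exact: cvg_nnsfun_approx.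
- by move=> n; apply: emeasurable_funM; apply/measurable_EFinP.
- by move=> n ? _; rewrite mule_ge0// lee_fin.
- move=> x _ m n mn; apply: lee_wpmul2r; first by rewrite lee_fin.
  by rewrite lee_fin; exact/lefP/nd_nnsfun_approx.
Qed.

End density.

Section affine.
Context (R : realType).
Local Notation mu := (@lebesgue_measure R).

(** By uniqueness of Lebesgue measure on half-open intervals, it equals |s| times its own
    pushforward under x -> m + s x; the formula is then integration against a pushforward. *)
Lemma ge0_integral_lebesgue_affine (m s : R) (f : R -> R) : s != 0 ->
  measurable_fun setT f -> (forall x, 0 <= f x) ->
  (\int[mu]_x (f x)%:E = `|s|%:E * \int[mu]_x (f (m + s * x))%:E)%E.
Proof.
move=> s0 mf f0.
pose g (x : R) : measurableTypeR R := m + s * x.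
have mg : measurable_fun setT g.
  by apply: measurable_funD => //; exact: measurable_funM.
have s_ge0 : 0 <= `|s| by [].
pose nu0 : {measure set (measurableTypeR R) -> \bar R} :=
  mscale (NngNum s_ge0) (pushforward mu g).
pose nu := nu0 mg.
have E A : measurable A -> mu A = nu A.
  apply: lebesgue_measure_unique => _ [[a b]] _ <-.
  rewrite /nu/= /mscale/= /pushforward.
  have [sp|sn] := ltP 0 s.
    have -> : g @^-1` `]a, b] = `](a - m) / s, (b - m) / s]%classic.
      apply/seteqP; split => x/=; rewrite !in_itv/= /g ltr_pdivrMr// ler_pdivlMr//;
        by rewrite ltrBlDl lerBrDl [x * s]mulrC.
    rewrite !lebesgue_measure_itv/= !lte_fin ltr_pM2r ?invr_gt0// ltrD2r.
    case: ifPn => // _; last by rewrite mule0.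
    rewrite -!EFinB -EFinM gtr0_norm//; congr _%:E; field.
    by rewrite gt_eqF.
  (* A negative slope turns the preimage of an interval open on the left into one open on the right,
     of the same length. *)
  have {}sn : s < 0 by rewrite lt_neqAle s0.
  have -> : g @^-1` `]a, b] = `[(b - m) / s, (a - m) / s[%classic.
    apply/seteqP; split => x/=; rewrite !in_itv/= /g ler_ndivrMr// ltr_ndivlMr//;
      by rewrite ltrBlDl lerBrDl [x * s]mulrC andbC.
  rewrite !lebesgue_measure_itv/= !lte_fin ltr_nM2r ?invr_lt0// ltrD2r.
  case: ifPn => // _; last by rewrite mule0.
  rewrite -!EFinB -EFinM ltr0_norm//; congr _%:E; field.
  by rewrite lt_eqF.
transitivity (\int[nu]_x (f x)%:E)%E.
  by apply: eq_measure_integral => A mA sA; exact: E.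
rewrite ge0_integral_mscale//; last 2 first.
  exact/measurable_EFinP.
  by move=> x _; rewrite lee_fin.
congr (_ * _)%E.
rewrite ge0_integral_pushforward//.
exact/measurable_EFinP.
by move=> x _; rewrite lee_fin.
Qed.

End affine.

Section gauss.
Context (R : realType).
Local Notation mu := (@lebesgue_measure R).
Local Notation gauss := (@normal_prob R 0 1).
Local Notation phi := (@normal_pdf R 0 1).

Lemma normal_pdf01E (x : R) : phi x = phi 0 * expR (- (x ^+ 2 / 2)).
Proof.
rewrite !normal_pdfE ?oner_eq0//= /normal_fun !subr0 expr0n/= oppr0 mul0r expR0.
by rewrite expr1n mulr1 mulNr.
Qed.

Lemma ge0_integral_gauss (g : R -> \bar R) :
  measurable_fun setT g -> (forall x, 0 <= g x)%E ->
  (\int[gauss]_x g x = \int[mu]_x (g x * (phi x)%:E))%E.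
Proof.
move=> mg g0.
apply: (@ge0_integral_density _ _ _ mu gauss phi) => //.
  exact: measurable_normal_pdf.
by move=> x; exact: normal_pdf_ge0.
Qed.

(** The integrand times the density is the density again, evaluated at k x with k = sqrt (1 - 2
    theta); rescaling costs the factor 1 / k. *)
Lemma mgf_gauss_sqr (theta : R) : theta < 2^-1 ->
  (\int[gauss]_x (expR (theta * x ^+ 2))%:E = ((Num.sqrt (1 - 2 * theta))^-1)%:E)%E.
Proof.
move=> ht; set k := Num.sqrt _.
have k0 : 0 < k by rewrite sqrtr_gt0; lra.
have mE : measurable_fun setT (fun x : R => expR (theta * x ^+ 2)).
  apply: measurableT_comp => //; apply: measurable_funM => //.
rewrite ge0_integral_gauss; [|exact/measurable_EFinP|by move=> x; rewrite lee_fin expR_ge0].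
under eq_integral.
  move=> x _; rewrite -EFinM.
  have -> : expR (theta * x ^+ 2) * phi x = phi (0 + k * x).
    rewrite add0r normal_pdf01E [RHS]normal_pdf01E mulrCA -expRD; congr (_ * expR _).
    rewrite exprMn sqr_sqrtr; last lra.
    by field.
  over.
have H := integral_normal_pdf (0 : R) 1.
rewrite (@ge0_integral_lebesgue_affine R 0 k) in H; last 3 first.
- by rewrite gt_eqF.
- exact: measurable_normal_pdf.
- by move=> x; exact: normal_pdf_ge0.
by rewrite -[RHS]mule1 -[in RHS]H muleA -EFinM gtr0_norm// mulVf ?gt_eqF// mul1e.
Qed.

End gauss.

Section gauss2.
Context (R : realType).
Local Notation mu := (@lebesgue_measure R).
Local Notation gauss := (@normal_prob R 0 1).
Local Notation phi := (@normal_pdf R 0 1).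

Let measurable_phi : measurable_fun setT phi.
Proof. exact: measurable_normal_pdf. Qed.

Let phi_ge0 x : 0 <= phi x.
Proof. exact: normal_pdf_ge0. Qed.

Lemma measure_gaussE (B : set R) : measurable B ->
  gauss B = (\int[mu]_x (\1_B x * phi x)%:E)%E.
Proof.
move=> mB; transitivity (\int[gauss]_x (\1_B x)%:E)%E.
  by rewrite integral_indic// setIT.
rewrite ge0_integral_gauss; last 2 first.
- exact/measurable_EFinP/measurable_indic.
- by move=> x; rewrite lee_fin.
by [].
Qed.

Lemma measurable_affine_preimage (m s : R) (B : set R) : measurable B ->
  measurable ((fun y : R => m + s * y) @^-1` B).
Proof.
move=> mB; rewrite -[X in measurable X]setTI.
suff : measurable_fun setT (fun y : R => m + s * y) by apply.
by apply: measurable_funD => //; exact: measurable_funM.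
Qed.

(** Writes the law of m + s g through its density, so that [B] appears as a function of the
    integration variable alone and Tonelli can exchange integrals in [rotation]. *)
Lemma gauss_affine (m s : R) (B : set R) : s != 0 -> measurable B ->
  gauss ((fun y : R => m + s * y) @^-1` B) =
  (`|s|^-1%:E * \int[mu]_u (\1_B u * phi ((u - m) / s))%:E)%E.
Proof.
move=> s0 mB; rewrite measure_gaussE; last exact: measurable_affine_preimage.
rewrite [in RHS](@ge0_integral_lebesgue_affine R m s)//.
- rewrite muleA -EFinM mulVf ?normr_eq0// mul1e; apply: eq_integral => y _.
  by congr (_ * phi _)%:E; rewrite addrAC subrr add0r mulrAC divff// mul1r.
- apply: measurable_funM; first exact: measurable_indic.
  apply: measurableT_comp => //; apply: measurable_funM => //.
  exact: measurable_funB.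
- by move=> x; rewrite mulr_ge0.
Qed.

(** With u = a x + b y, the joint density of (x, u) is phi(x) phi((u - a x) / b) / |b|. Since a^2 +
    b^2 = 1 it also equals phi(u) phi((x - a u) / b) / |b|, whose integral over x is phi(u). *)
Let rotation (a b : R) (B : set R) : b != 0 -> a ^+ 2 + b ^+ 2 = 1 ->
  measurable B ->
  (\int[gauss]_x gauss ((fun y : R => (a * x + b * y)%R) @^-1` B) = gauss B)%E.
Proof.
move=> b0 ab1 mB.
pose f (z : R * R) : \bar R :=
  (`|b|^-1 * (\1_B z.2 * phi ((z.2 - a * z.1) / b) * phi z.1))%:E.
have mf : measurable_fun setT f.
  apply/measurable_EFinP; apply: measurable_funM => //.
  apply: measurable_funM; last by apply: measurableT_comp.
  apply: measurable_funM.
    by apply: measurableT_comp => //; exact: measurable_indic.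
  apply: measurableT_comp => //; apply: measurable_funM => //.
  by apply: measurable_funB => //; apply: measurable_funM.
have f0 z : (0 <= f z)%E by rewrite lee_fin !mulr_ge0 ?invr_ge0.
have f2 x : (gauss ((fun y : R => (a * x + b * y)%R) @^-1` B) * (phi x)%:E =
             \int[mu]_y f (x, y))%E.
  rewrite gauss_affine// muleAC -EFinM -ge0_integralZl//; last 3 first.
  - apply/measurable_EFinP; apply: measurable_funM; first exact: measurable_indic.
    apply: measurableT_comp => //; apply: measurable_funM => //.
    exact: measurable_funB.
  - by move=> u _; rewrite lee_fin mulr_ge0.
  - by rewrite lee_fin mulr_ge0// invr_ge0.
  apply: eq_integral => u _; rewrite /f/= -EFinM; congr _%:E; ring.
rewrite ge0_integral_gauss; last 2 first.
- have -> : (fun x => gauss ((fun y : R => (a * x + b * y)%R) @^-1` B)) =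
      gauss \o xsection [set z : R * R | B (a * z.1 + b * z.2)].
    apply/funext => x /=; congr (normal_prob 0 1 _).
    by apply/seteqP; split => y; rewrite /xsection/= ?inE// => /mem_set; rewrite inE.
  apply: measurable_fun_xsection.
  rewrite -[X in measurable X]setTI.
  suff : measurable_fun setT (fun z : R * R => a * z.1 + b * z.2) by apply.
  by apply: measurable_funD; apply: measurable_funM.
- by move=> x; exact: measure_ge0.
under eq_integral do rewrite f2.
rewrite (@fubini_tonelli _ _ _ _ _ mu mu f mf f0) measure_gaussE//; apply: eq_integral => u _.
transitivity (\int[mu]_x ((\1_B u * phi u)%:E * (`|b|^-1 * phi ((x - a * u) / b))%:E))%E.
  apply: eq_integral => x _; rewrite -EFinM /f/=; congr _%:E.
  rewrite [phi (_ / b)]normal_pdf01E [phi x]normal_pdf01E.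
  rewrite [phi u]normal_pdf01E [phi (_ / b)]normal_pdf01E.
  have E : expR (- (((u - a * x) / b) ^+ 2 / 2)) * expR (- (x ^+ 2 / 2)) =
           expR (- (u ^+ 2 / 2)) * expR (- (((x - a * u) / b) ^+ 2 / 2)).
    rewrite -!expRD; congr expR.
    apply/eqP; rewrite -subr_eq0; apply/eqP.
    (* The two quadratic forms differ by a multiple of a^2 + b^2 - 1. *)
    transitivity ((a ^+ 2 + b ^+ 2 - 1) * (u ^+ 2 - x ^+ 2) / (2 * b ^+ 2)); first by field.
    by rewrite ab1 subrr !mul0r.
  transitivity (`|b|^-1 * \1_B u * phi 0 * phi 0 *
    (expR (- (((u - a * x) / b) ^+ 2 / 2)) * expR (- (x ^+ 2 / 2)))); first by ring.
  by rewrite E; ring.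
rewrite ge0_integralZl//; last 3 first.
- apply/measurable_EFinP; apply: measurable_funM => //.
  apply: measurableT_comp => //; apply: measurable_funM => //.
  exact: measurable_funB.
- by move=> x _; rewrite lee_fin mulr_ge0// invr_ge0.
- by rewrite lee_fin mulr_ge0.
rewrite -[RHS]mule1; congr (_ * _)%E.
(* The remaining integral over x is the total mass of a Gaussian with mean a u and scale |b|. *)
have := @gauss_affine (a * u) b setT b0 measurableT.
rewrite preimage_setT probability_setT => ->.
rewrite -ge0_integralZl//; last 2 first.
- apply/measurable_EFinP; apply: measurable_funM; first exact: measurable_indic.
  apply: measurableT_comp => //; apply: measurable_funM => //.
  exact: measurable_funB.
- by move=> x _; rewrite lee_fin mulr_ge0.
by apply: eq_integral => x _; rewrite -EFinM indicT mul1r.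
Qed.

(* Completing the square: a rotation of the plane preserves the standard
   Gaussian law. *)
Lemma gauss_conv (a b : R) (B : set R) : 0 <= a -> measurable B ->
  (\int[gauss]_x gauss ((fun y : R => (a * x + b * y)%R) @^-1` B) =
   gauss ((fun z : R => (Num.sqrt (a ^+ 2 + b ^+ 2) * z)%R) @^-1` B))%E.
Proof.
(* With b = 0 the inner law is a point mass without density, so this case is separate; there 0 <= a
   identifies sqrt (a^2) with a. *)
move=> a0 mB; have [->|b0] := eqVneq b 0.
  rewrite expr0n addr0 sqrtr_sqr ger0_norm//.
  have mB' := measurable_affine_preimage 0 a mB.
  transitivity (\int[gauss]_x (\1_((fun y : R => 0 + a * y) @^-1` B) x)%:E)%E.
    apply: eq_integral => x _; rewrite indicE.
    have -> : (fun y : R => (a * x + 0 * y)%R) = cst (a * x).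
      by apply/funext => y; rewrite mul0r addr0.
    have -> : (x \in (fun y : R => 0 + a * y) @^-1` B) = (a * x \in B).
      by apply/idP/idP; rewrite !inE /= add0r.
    by rewrite preimage_cst; case: ifPn => _; rewrite ?probability_setT ?measure0.
  rewrite integral_indic// setIT; congr (gauss _).
  by apply/seteqP; split => x /=; rewrite add0r.
set r := Num.sqrt _.
have r0 : 0 < r by rewrite sqrtr_gt0 ltr_wpDl ?sqr_ge0// exprn_even_gt0.
have mB' := measurable_affine_preimage 0 r mB.
have ab1 : (a / r) ^+ 2 + (b / r) ^+ 2 = 1.
  rewrite !expr_div_n sqr_sqrtr ?addr_ge0 ?sqr_ge0// -mulrDl divff//.
  by rewrite gt_eqF// ltr_wpDl ?sqr_ge0// exprn_even_gt0.
have := @rotation (a / r) (b / r) _ _ ab1 mB'.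
rewrite mulf_neq0 ?invr_eq0 ?(gt_eqF r0)// => /(_ isT).
have -> : (fun y : R => 0 + r * y) = (fun y : R => r * y).
  by apply/funext => y; rewrite add0r.
move=> <-; apply: eq_integral => x _; congr (gauss _).
have e y : r * (a / r * x + b / r * y) = a * x + b * y by field; rewrite gt_eqF.
by apply/seteqP; split => y /=; rewrite e.
Qed.

End gauss2.

Section chi2_law.
Context (R : realType).
Local Notation gauss := (@normal_prob R 0 1).

(** For theta < 1/2, the moment generating function of the square of one standard Gaussian. *)
Definition chi2_mgf (theta : R) : R := (Num.sqrt (1 - 2 * theta))^-1.

Lemma chi2_mgf_ge0 theta : 0 <= chi2_mgf theta.
Proof. by rewrite invr_ge0 sqrtr_ge0. Qed.

(** A crude constant suffices: x^2 <= 4 exp(x^2 / 4), and the generating function at 1/4 is sqrt 2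
    <= 3/2. *)
Lemma second_moment_gauss : (\int[gauss]_x (x ^+ 2)%:E <= 6%:E)%E.
Proof.
apply: (@le_trans _ _ (\int[gauss]_x (4%:E * (expR (4^-1 * x ^+ 2))%:E))%E).
  apply: ge0_le_integral => //.
  - by move=> x _; rewrite lee_fin sqr_ge0.
  - exact/measurable_EFinP.
  - apply/measurable_EFinP; apply: measurable_funM => //.
    by apply: measurableT_comp => //; apply: measurable_funM.
  - move=> x _; rewrite -EFinM lee_fin.
    by have := expR_ge1Dx (4^-1 * x ^+ 2); lra.
rewrite ge0_integralZl//; last first.
  apply/measurable_EFinP.
  by apply: measurableT_comp => //; apply: measurable_funM.
rewrite mgf_gauss_sqr; last lra.
rewrite -EFinM lee_fin.
have s : 2 / 3 <= Num.sqrt (1 - 2 * 4^-1 : R).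
  rewrite -(@ler_pXn2r _ 2) ?nnegrE ?sqrtr_ge0//.
  by rewrite sqr_sqrtr; lra.
by rewrite ler_pdivrMr; lra.
Qed.

Lemma chi2_law (m : nat) : exists mu : probability (measurableTypeR R) R,
  [/\ forall B, measurable B -> chi2_prob m B = mu B,
      forall theta, theta < 2^-1 ->
        (\int[mu]_x (expR (theta * x))%:E = (chi2_mgf theta ^+ m)%:E)%E &
      (\int[mu]_x `|x|%:E <= (6 * m%:R)%:E)%E].
Proof.
elim: m => [|m [mu [mu1 mu2 mu3]]].
  exists (@dirac _ (measurableTypeR R) 0 R); split=> //.
  - move=> theta _; rewrite integral_dirac//; first last.
      apply/measurable_EFinP.
      by apply: measurableT_comp => //; apply: measurable_funM.
    by rewrite diracT mul1e mulr0 expR0 expr0.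
  - rewrite integral_dirac//; first last.
      by apply/measurable_EFinP.
    by rewrite diracT mul1e normr0 mulr0.
pose F (z : measurableTypeR R * measurableTypeR R) : measurableTypeR R :=
  (z.2 : R) + (z.1 : R) ^+ 2.
have mF : measurable_fun setT F.
  have m2 : measurable_fun setT (fun z : measurableTypeR R * measurableTypeR R => z.2 : R).
    exact: measurable_snd.
  have m1 : measurable_fun setT (fun z : measurableTypeR R * measurableTypeR R => z.1 : R).
    exact: measurable_fst.
  exact: (measurable_funD m2 (measurable_funX 2 m1)).
pose X : {mfun (measurableTypeR R * measurableTypeR R)%type >-> measurableTypeR R} :=
  mfun_Sub (mem_set mF).
pose nu : probability (measurableTypeR R * measurableTypeR R)%type R := (gauss \x mu)%E.
have mexp theta : measurable_fun setT (fun x : R => (expR (theta * x))%:E).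
  by apply/measurable_EFinP; apply: measurableT_comp => //; apply: measurable_funM.
have mexp2 theta : measurable_fun setT (fun x : R => (expR (theta * x ^+ 2))%:E).
  by apply/measurable_EFinP; apply: measurableT_comp => //; apply: measurable_funM.
have mabs : measurable_fun setT (fun x : R => `|x|%:E).
  exact/measurable_EFinP.
exists (distribution nu X); split.
- move=> B mB /=; rewrite /distribution/= /pushforward/= /product_measure1/=.
  apply: eq_integral => x _.
  have mB' : measurable [set v : R | B (v + x ^+ 2)].
    have := measurable_affine_preimage (x ^+ 2) 1 mB.
    by congr measurable; apply/seteqP; split => y /=; rewrite mul1r addrC.
  rewrite mu1//; congr (mu _).
  by apply/seteqP; split => y; rewrite /xsection/= ?inE// => /set_mem.
- move=> theta ht; rewrite ge0_integral_distribution; last 2 first.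
  + exact: mexp.
  + by move=> y; rewrite lee_fin expR_ge0.
  rewrite fubini_tonelli1; last 2 first.
  + exact: measurableT_comp (mexp theta) mF.
  + by move=> z; rewrite lee_fin expR_ge0.
  rewrite /fubini_F/= /F.
  transitivity (\int[gauss]_x ((chi2_mgf theta ^+ m)%:E * (expR (theta * x ^+ 2))%:E))%E.
    apply: eq_integral => x _; rewrite -mu2// -ge0_integralZr//.
    + by apply: eq_integral => y _; rewrite mulrDr expRD EFinM.
    + exact: mexp.
  rewrite ge0_integralZl; [|by []|exact: mexp2| |]; last 2 first.
  + by move=> y _; rewrite lee_fin expR_ge0.
  + by rewrite lee_fin exprn_ge0 ?chi2_mgf_ge0.
  by rewrite mgf_gauss_sqr// -EFinM exprSr.
- rewrite ge0_integral_distribution//.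
  rewrite fubini_tonelli1; last 2 first.
  + exact: measurableT_comp mabs mF.
  + by move=> z; rewrite lee_fin.
  apply: (@le_trans _ _ (\int[gauss]_x ((6 * m%:R)%:E + (x ^+ 2)%:E))%E).
    apply: ge0_le_integral => //.
    + by move=> x _; apply: integral_ge0 => y _; rewrite lee_fin.
    + apply: (@measurable_fun_fubini_tonelli_F _ _ _ _ _ mu) => //.
        exact: measurableT_comp mabs mF.
      by move=> z; rewrite lee_fin.
    + by apply: emeasurable_funD => //; exact/measurable_EFinP.
    + move=> x _; rewrite /fubini_F/=.
      apply: (@le_trans _ _ (\int[mu]_y (`|y|%:E + (x ^+ 2)%:E))%E).
        apply: ge0_le_integral => //.
        * apply: measurableT_comp mabs _.
          exact: (measurable_fun_pair2 x mF).
        * by apply: emeasurable_funD.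
        * move=> y _; rewrite -EFinD lee_fin (le_trans (ler_normD _ _))//.
          by rewrite (ger0_norm (sqr_ge0 x)).
      rewrite ge0_integralD//; last by move=> y _; rewrite lee_fin sqr_ge0.
      have -> : (\int[mu]__ (x ^+ 2)%:E = (x ^+ 2)%:E)%E.
        by rewrite (integral_cst mu measurableT) [X in (_ * X)%E]probability_setT mule1.
      exact: leeD.
  rewrite ge0_integralD//.
  + have -> : (\int[gauss]__ (6 * m%:R)%:E = (6 * m%:R)%:E)%E.
      by rewrite (integral_cst gauss measurableT) [X in (_ * X)%E]probability_setT mule1.
    rewrite -[m.+1%:R]natr1 mulrDr mulr1 EFinD; apply: leeD => //.
    exact: second_moment_gauss.
  + by move=> x _; rewrite lee_fin sqr_ge0.
  + exact/measurable_EFinP.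
Qed.

End chi2_law.

(** * Chernoff bounds for the chi-squared law *)

Section chi2_tails.
Context (R : realType).

(** Covers both tails: [A] may lie to the right of x when theta >= 0, and to the left of x when
    theta <= 0. *)
Lemma markov_expR (mu : probability (measurableTypeR R) R) (theta x : R)
    (A : set R) : measurable A -> (forall y, A y -> theta * x <= theta * y) ->
  (mu A <= (expR (- (theta * x)))%:E * \int[mu]_y (expR (theta * y))%:E)%E.
Proof.
move=> mA Ax.
have mexp : measurable_fun setT (fun x : R => (expR (theta * x))%:E).
  by apply/measurable_EFinP; apply: measurableT_comp => //; apply: measurable_funM.
rewrite -ge0_integralZl; [|by []|exact: mexp|by move=> y _; rewrite lee_fin expR_ge0|
  by rewrite lee_fin expR_ge0].
rewrite -(setIT A) -(integral_indic mu measurableT mA).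
apply: ge0_le_integral => //.
- exact/measurable_EFinP/measurable_indic.
- by apply: emeasurable_funM => //; exact: mexp.
- move=> y _; rewrite -EFinM lee_fin -expRD indicE.
  case: (boolP (y \in A)) => /= [|_]; last by rewrite expR_ge0.
  rewrite inE => /Ax h; rewrite -[leLHS]expR0 ler_expR; lra.
Qed.

Lemma chi2_prob_le (m : nat) (theta x : R) : 0 <= theta ->
  (chi2_prob m `]-oo, x] <= (expR (theta * x) * chi2_mgf (- theta) ^+ m)%:E)%E.
Proof.
move=> t0; have [mu [mu1 mu2 _]] := chi2_law R m.
rewrite mu1// EFinM -mu2; last lra.
apply: le_trans (@markov_expR mu (- theta) x _ _ _) _ => //.
  by move=> y /=; rewrite in_itv/= => yx; rewrite !mulNr lerN2 ler_wpM2l.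
by rewrite mulNr opprK.
Qed.

Lemma chi2_prob_ge (m : nat) (theta x : R) : 0 <= theta < 2^-1 ->
  (chi2_prob m `[x, +oo[ <= (expR (- (theta * x)) * chi2_mgf theta ^+ m)%:E)%E.
Proof.
move=> /andP[t0 t1]; have [mu [mu1 mu2 _]] := chi2_law R m.
rewrite mu1// EFinM -mu2//.
apply: markov_expR => //.
by move=> y /=; rewrite in_itv/= andbT => yx; rewrite ler_wpM2l.
Qed.

Lemma chi2_prob_lower (m : nat) :
  (chi2_prob m `]-oo, (m%:R / 16 : R)%R] <= (expR (- (m%:R / 2)))%:E)%E.
Proof.
(* At theta = 4 the generating function is 1/3, and the claim per degree of freedom is exp(1/4) / 3
   <= exp(-1/2), that is exp(3/4) <= 3. It follows from exp(1/4) <= 4/3. *)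
apply: le_trans (@chi2_prob_le m 4 _ _) _; first by [].
rewrite lee_fin.
have -> : 4 * (m%:R / 16) = m%:R * (1 / 4) :> R by field.
have -> : - (m%:R / 2) = m%:R * (- (1 / 2)) :> R by field.
rewrite !expRM_natl -exprMn; apply: lerXn2r; rewrite ?nnegrE.
- by rewrite mulr_ge0 ?expR_ge0 ?chi2_mgf_ge0.
- by rewrite expR_ge0.
rewrite /chi2_mgf.
have -> : 1 - 2 * - 4 = 3 ^+ 2 :> R by ring.
rewrite sqrtr_sqr ger0_norm// ler_pdivrMr//.
have -> : 1 / 4 = - (1 / 2) + 3%:R * (1 / 4) :> R by field.
rewrite expRD ler_pM2l ?expR_gt0// expRM_natl.
have h : expR (1 / 4) <= 4 / 3 :> R.
  rewrite -[leLHS]invrK -expRN -[leRHS]invrK lef_pV2 ?posrE ?expR_gt0//.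
  by have := expR_ge1Dx (- (1 / 4) : R); lra.
apply: (@le_trans _ _ ((4 / 3) ^+ 3)).
  by apply: lerXn2r; rewrite ?nnegrE ?expR_ge0.
lra.
Qed.

Lemma chi2_prob_upper (m : nat) :
  (chi2_prob m `[(4 * m%:R : R)%R, +oo[ <= (expR (- (m%:R / 2)))%:E)%E.
Proof.
(* At theta = 1/4 the generating function is sqrt 2, and the claim per degree of freedom reduces to
   2 <= exp 1. *)
apply: le_trans (@chi2_prob_ge m (1 / 4) _ _) _; first lra.
rewrite lee_fin.
have -> : - (1 / 4 * (4 * m%:R)) = m%:R * (- 1) :> R by field.
have -> : - (m%:R / 2) = m%:R * (- (1 / 2)) :> R by field.
rewrite !expRM_natl -exprMn; apply: lerXn2r; rewrite ?nnegrE.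
- by rewrite mulr_ge0 ?expR_ge0 ?chi2_mgf_ge0.
- by rewrite expR_ge0.
rewrite /chi2_mgf.
have s0 : 0 < Num.sqrt (1 - 2 * (1 / 4)) :> R by rewrite sqrtr_gt0; lra.
rewrite ler_pdivrMr//.
have -> : - 1 = - (1 / 2) - 1 / 2 :> R by field.
rewrite expRD ler_pM2l ?expR_gt0//.
rewrite -(@ler_pXn2r _ 2) ?nnegrE ?expR_ge0 ?sqrtr_ge0//.
rewrite sqr_sqrtr; last lra.
rewrite -expRM_natl.
have -> : 2 * - (1 / 2) = - 1 :> R by field.
have -> : 1 - 2 * (1 / 4) = 2^-1 :> R by field.
rewrite expRN lef_pV2 ?posrE ?expR_gt0//.
by have := expR_ge1Dx (1 : R); lra.
Qed.

(** Take theta = u / 2 with u = 1 / (2 sqrt m). The terms linear in u cancel, the quadratic one is m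
    u^2 = 1/4, and the deviation contributes - t / 4. *)
Lemma chi2_prob_upper_dev (m : nat) (t : R) : (0 < m)%N ->
  (chi2_prob m `[(m%:R + t * Num.sqrt m%:R)%R, +oo[ <= (expR ((1 - t) / 4))%:E)%E.
Proof.
move=> m0; have m1 : 1 <= m%:R :> R by rewrite ler1n.
set r := Num.sqrt m%:R.
have rr : r ^+ 2 = m%:R by rewrite sqr_sqrtr.
have r1 : 1 <= r by rewrite -(@ler_pXn2r _ 2) ?nnegrE ?sqrtr_ge0// rr expr1n.
have r0 : 0 < r by lra.
pose u := (2 * r)^-1.
have u0 : 0 < u by rewrite invr_gt0; lra.
have u1 : u <= 2^-1 by rewrite lef_pV2 ?posrE; lra.
have ur : u * r = 2^-1 by rewrite /u; field; rewrite gt_eqF.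
apply: le_trans (@chi2_prob_ge m (u / 2) _ _) _; first by apply/andP; split; lra.
rewrite lee_fin.
have mg : chi2_mgf (u / 2) <= expR (u / 2 + u ^+ 2).
  rewrite /chi2_mgf.
  have -> : 1 - 2 * (u / 2) = 1 - u by field.
  have s0 : 0 < Num.sqrt (1 - u) by rewrite sqrtr_gt0; lra.
  rewrite -[leLHS]mul1r ler_pdivrMr// -(@ler_pXn2r _ 2) ?nnegrE ?mulr_ge0 ?expR_ge0 ?sqrtr_ge0//.
  rewrite expr1n exprMn sqr_sqrtr; last lra.
  rewrite -expRM_natl.
  have -> : 2 * (u / 2 + u ^+ 2) = u + 2 * u ^+ 2 by field.
  apply: (@le_trans _ _ ((1 + (u + 2 * u ^+ 2)) * (1 - u))); last first.
    by rewrite ler_wpM2r ?expR_ge1Dx//; lra.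
  (* The product exceeds 1 by u^2 (1 - 2 u), which is nonnegative since u <= 1/2. *)
  nra.
apply: (@le_trans _ _ (expR (- (u / 2 * (m%:R + t * r))) * expR (u / 2 + u ^+ 2) ^+ m)).
  rewrite ler_wpM2l ?expR_ge0//; apply: lerXn2r; rewrite ?nnegrE ?expR_ge0//.
  exact: chi2_mgf_ge0.
rewrite -expRM_natl -expRD ler_expR -rr.
have -> : - (u / 2 * (r ^+ 2 + t * r)) + r ^+ 2 * (u / 2 + u ^+ 2) =
  (u * r) ^+ 2 - (u * r) * t / 2 by field.
rewrite ur; lra.
Qed.

(** Same computation with u = 2 / sqrt m. The generating function is now evaluated at a negative
    argument, where it is finite, so u need not be small. *)
Lemma chi2_prob_lower_dev (m : nat) (t : R) : (0 < m)%N ->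
  (chi2_prob m `]-oo, (m%:R - t * Num.sqrt m%:R)%R] <= (expR (2 - t))%:E)%E.
Proof.
move=> m0; have m1 : 1 <= m%:R :> R by rewrite ler1n.
set r := Num.sqrt m%:R.
have rr : r ^+ 2 = m%:R by rewrite sqr_sqrtr.
have r1 : 1 <= r by rewrite -(@ler_pXn2r _ 2) ?nnegrE ?sqrtr_ge0// rr expr1n.
have r0 : 0 < r by lra.
pose u := 2 / r.
have u0 : 0 < u by rewrite divr_gt0.
have ur : u * r = 2 by rewrite /u; field; rewrite gt_eqF.
apply: le_trans (@chi2_prob_le m (u / 2) _ _) _; first by lra.
rewrite lee_fin.
have mg : chi2_mgf (- (u / 2)) <= expR (- (u / 2) + u ^+ 2 / 2).
  rewrite /chi2_mgf.
  have -> : 1 - 2 * - (u / 2) = 1 + u by field.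
  have s0 : 0 < Num.sqrt (1 + u) by rewrite sqrtr_gt0; lra.
  rewrite -[leLHS]mul1r ler_pdivrMr// -(@ler_pXn2r _ 2) ?nnegrE ?mulr_ge0 ?expR_ge0 ?sqrtr_ge0//.
  rewrite expr1n exprMn sqr_sqrtr; last lra.
  rewrite -expRM_natl.
  have -> : 2 * (- (u / 2) + u ^+ 2 / 2) = - u + u ^+ 2 by field.
  apply: (@le_trans _ _ ((1 + (- u + u ^+ 2)) * (1 + u))); last first.
    by rewrite ler_wpM2r ?expR_ge1Dx//; lra.
  have -> : (1 + (- u + u ^+ 2)) * (1 + u) = 1 + u ^+ 3 by ring.
  by rewrite lerDl exprn_ge0// ltW.
apply: (@le_trans _ _ (expR (u / 2 * (m%:R - t * r)) * expR (- (u / 2) + u ^+ 2 / 2) ^+ m)).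
  rewrite ler_wpM2l ?expR_ge0//; apply: lerXn2r; rewrite ?nnegrE ?expR_ge0//.
  exact: chi2_mgf_ge0.
rewrite -expRM_natl -expRD ler_expR -rr.
have -> : u / 2 * (r ^+ 2 - t * r) + r ^+ 2 * (- (u / 2) + u ^+ 2 / 2) =
  (u * r) ^+ 2 / 2 - (u * r) * t / 2 by field.
rewrite ur; lra.
Qed.

(** Needed for a lower bound of order m on the quantile for every m >= 1: m - t sqrt m can be
    negative for small m. The Chernoff bound at theta = B is the m-th power of exp(1) / sqrt (1 + 2
    B) <= delta <= 1, hence at most delta. *)
Lemma chi2_prob_small_ball (delta : R) : 0 < delta <= 1 ->
  exists2 B : R, 0 < B & forall m, (0 < m)%N ->
    (chi2_prob m `]-oo, (m%:R / B)%R] <= delta%:E)%E.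
Proof.
move=> /andP[d0 d1].
pose B := (expR 1 / delta) ^+ 2.
have B0 : 0 < B by rewrite exprn_gt0// divr_gt0// expR_gt0.
exists B => // m m0.
apply: le_trans (@chi2_prob_le m B _ (ltW B0)) _; rewrite lee_fin.
have -> : B * (m%:R / B) = m%:R * 1 by field; rewrite gt_eqF.
rewrite expRM_natl -exprMn.
have h : expR 1 * chi2_mgf (- B) <= delta.
  rewrite /chi2_mgf.
  have -> : 1 - 2 * - B = 1 + 2 * B by ring.
  have s0 : 0 < Num.sqrt (1 + 2 * B) by rewrite sqrtr_gt0; lra.
  rewrite ler_pdivrMr// mulrC -ler_pdivrMr//.
  rewrite -(@ler_pXn2r _ 2) ?nnegrE ?sqrtr_ge0// ?divr_ge0 ?expR_ge0 ?(ltW d0)//.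
  by rewrite sqr_sqrtr -/B; lra.
have h0 : 0 <= expR 1 * chi2_mgf (- B) by rewrite mulr_ge0 ?expR_ge0 ?chi2_mgf_ge0.
rewrite -(prednK m0) exprS; apply: le_trans (h).
rewrite ler_piMr// exprn_ile1//.
lra.
Qed.

End chi2_tails.

(** * Quantiles of the chi-squared law *)

Section chi2_quantiles.
Context (R : realType).

Lemma measure_bigcup_le d (T : measurableType d) (mu : {measure set T -> \bar R})
    (F : (set T)^nat) (c : \bar R) :
  (forall i, measurable (F i)) -> nondecreasing_seq F ->
  (forall i, (mu (F i) <= c)%E) -> (mu (\bigcup_i F i) <= c)%E.
Proof.
move=> mF ndF Fc.
have h := nondecreasing_cvg_mu (mu := mu) mF (bigcup_measurable (fun k _ => mF k)) ndF.
rewrite -(cvg_lim _ h)//; apply: lime_le; first by apply/cvg_ex; exists (mu (\bigcup_i F i)).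
exact: nearW.
Qed.

Section quantile_level.
Variables (m : nat) (tau : R).
Let S := [set q : R | (tau%:E <= chi2_prob m `]-oo, q])%E].

(** The member q of [S] keeps the infimum from being taken over the empty set, where [inf] has a
    default value. In the next lemma r plays this role as a lower bound. *)
Lemma chi2_quantile_ge (r q : R) : S q -> (chi2_prob m `]-oo, r] < tau%:E)%E ->
  r <= chi2_quantile tau m.
Proof.
have [mu [muE _ _]] := chi2_law R m.
move=> Sq; rewrite muE// => hr; apply: lb_le_inf; first by exists q.
move=> y; rewrite /S/= muE// => ty; rewrite leNgt; apply/negP => yr.
move: (lt_le_trans hr ty); rewrite ltNge => /negP; apply.
apply: le_measure; rewrite ?inE//=.
by apply: subset_itvl; rewrite bnd_simp ltW.
Qed.

Lemma chi2_quantile_le (r q : R) : (chi2_prob m `]-oo, r] < tau%:E)%E -> S q ->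
  chi2_quantile tau m <= q.
Proof.
have [mu [muE _ _]] := chi2_law R m.
move=> hr Sq; apply: ge_inf => //.
exists r => y; rewrite /S/= muE// => ty; rewrite leNgt; apply/negP => yr.
move: hr; rewrite muE// => /lt_le_trans /(_ ty); rewrite ltNge => /negP; apply.
apply: le_measure; rewrite ?inE//=.
by apply: subset_itvl; rewrite bnd_simp ltW.
Qed.

(** No point strictly below the infimum belongs to [S]; pass to the limit along Q - 1 / (k + 1).
    With open half-lines here and in the next lemma, continuity of the law is never invoked. *)
Lemma chi2_prob_lt_quantile (r q : R) : (chi2_prob m `]-oo, r] < tau%:E)%E ->
  S q -> (chi2_prob m `]-oo, (chi2_quantile tau m)[ <= tau%:E)%E.
Proof.
have [mu [muE _ _]] := chi2_law R m.
move=> hr Sq; set Q := chi2_quantile tau m.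
have -> : `]-oo, Q[%classic = \bigcup_k `]-oo, Q - k.+1%:R^-1]%classic.
  apply/seteqP; split => y /=; rewrite in_itv/=.
    rewrite -subr_gt0 => /ltr_add_invr[k]. rewrite add0r => hk.
    exists k => //=; rewrite in_itv/=; move: hk; move: (_^-1) => e; lra.
  move=> [k _]/=; rewrite in_itv/=.
  have : 0 < k.+1%:R^-1 :> R by [].
  by move: (_^-1) => e; lra.
rewrite muE; last by apply: bigcup_measurable.
apply: measure_bigcup_le => //.
- apply/nondecreasing_seqP => k; apply/subsetPset/subset_itvl.
  by rewrite bnd_simp lerD2l lerN2 lef_pV2 ?posrE ?ler_nat.
- move=> k; rewrite leNgt; apply/negP => /ltW h.
  have h' : S (Q - k.+1%:R^-1) by rewrite /S/= muE.
  have := chi2_quantile_le hr h'; rewrite -/Q.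
  have : 0 < k.+1%:R^-1 :> R by [].
  by move: (_^-1) => e; lra.
Qed.

(** Just above the infimum there is a member of [S], so each half-line beyond Q + 1 / (k + 1) has
    mass at most 1 - tau. *)
Lemma chi2_prob_gt_quantile (q : R) : S q ->
  (chi2_prob m `](chi2_quantile tau m), +oo[ <= (1 - tau)%:E)%E.
Proof.
have [mu [muE _ _]] := chi2_law R m.
move=> Sq; set Q := chi2_quantile tau m.
have -> : `]Q, +oo[%classic = \bigcup_k `]Q + k.+1%:R^-1, +oo[%classic.
  apply/seteqP; split => y /=; rewrite in_itv/= andbT.
    by move=> /ltr_add_invr[k hk]; exists k => //=; rewrite in_itv/= hk.
  move=> [k _]/=; rewrite in_itv/= andbT.
  have : 0 < k.+1%:R^-1 :> R by [].
  by move: (_^-1) => e; lra.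
rewrite muE; last by apply: bigcup_measurable.
apply: measure_bigcup_le => //.
- apply/nondecreasing_seqP => k; apply/subsetPset/subset_itvr.
  by rewrite bnd_simp lerD2l lef_pV2 ?posrE ?ler_nat.
- move=> k.
  have [y Sy yQ] : exists2 y, S y & y < Q + k.+1%:R^-1.
    by apply: inf_lt; [exists q|rewrite -/S ltrDl].
  have -> : `]Q + k.+1%:R^-1, +oo[%classic = ~` `]-oo, Q + k.+1%:R^-1]%classic.
    by rewrite setCitvl.
  suff : (mu (~` `]-oo, (Q + k.+1%:R^-1)%R]%classic) <= (1 - tau)%:E)%E by [].
  rewrite probability_setC// EFinB leeB//; apply: le_trans (Sy) _.
  rewrite muE//; apply: le_measure; rewrite ?inE//=.
  by apply: subset_itvl; rewrite bnd_simp ltW.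
Qed.

End quantile_level.

Lemma chi2_quantile_bounds (a : R) : 0 < a < 2^-1 ->
  exists B D : R, 0 < B /\ 0 < D /\ forall m, (0 < m)%N ->
    let q1 := chi2_quantile a m in let q2 := chi2_quantile (1 - a) m in
    [/\ m%:R / B <= q1, q1 <= q2, q2 <= q1 + D * Num.sqrt m%:R,
        (chi2_prob m `]-oo, q1[ <= a%:E)%E & (chi2_prob m `]q2, +oo[ <= a%:E)%E].
Proof.
move=> /andP[a0 a1].
have [|B B0 hB] := @chi2_prob_small_ball R (a / 2); first by apply/andP; split; lra.
(* [t1] and [t2] solve exp(2 - t1) = a / 2 and exp((1 - t2) / 4) = a / 2, the two deviation bounds.
   The level a / 2 instead of a leaves room for strict inequalities. *)
pose t1 := 2 - ln (a / 2).
pose t2 := 1 - 4 * ln (a / 2).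
have lna : ln (a / 2) < 0 by apply: ln_lt0; apply/andP; split; lra.
have e1 : expR (2 - t1) = a / 2.
  by rewrite /t1 opprB addrCA subrr addr0 lnK// posrE divr_gt0.
have e2 : expR ((1 - t2) / 4) = a / 2.
  rewrite /t2; have -> : (1 - (1 - 4 * ln (a / 2))) / 4 = ln (a / 2) by field.
  by rewrite lnK// posrE divr_gt0.
exists B, (t1 + t2); split=> //; split; first by rewrite /t1 /t2; lra.
move=> m m0 q1 q2.
have [mu [muE _ _]] := chi2_law R m.
have h1 : (chi2_prob m `]-oo, (m%:R / B)%R] < a%:E)%E.
  by apply: le_lt_trans (hB _ m0) _; rewrite lte_fin; lra.
have h2 : (chi2_prob m `]-oo, (m%:R - t1 * Num.sqrt m%:R)%R] < a%:E)%E.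
  by apply: le_lt_trans (chi2_prob_lower_dev _ m0) _; rewrite e1 lte_fin; lra.
have h3 : ((1 - a)%:E <= chi2_prob m `]-oo, (m%:R + t2 * Num.sqrt m%:R)%R])%E.
  set x := (m%:R + _)%R.
  have -> : `]-oo, x]%classic = ~` `]x, +oo[%classic by rewrite setCitvr.
  rewrite muE; last exact: measurableC.
  rewrite probability_setC// EFinB leeB//.
  apply: (@le_trans _ _ (mu `[x, +oo[%classic)).
    by apply: le_measure; rewrite ?inE//=; apply: subset_itvr; rewrite bnd_simp.
  rewrite -muE//; apply: le_trans (chi2_prob_upper_dev _ m0) _.
  by rewrite e2 lee_fin; lra.
have h4 : (a%:E <= chi2_prob m `]-oo, (m%:R + t2 * Num.sqrt m%:R)%R])%E.
  by apply: le_trans h3; rewrite lee_fin; lra.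
have h5 : (chi2_prob m `]-oo, (m%:R / B)%R] < (1 - a)%:E)%E.
  by apply: lt_le_trans h1 _; rewrite lee_fin; lra.
split.
- exact: chi2_quantile_ge h4 h1.
- apply: lb_le_inf; first by eexists; exact: h3.
  move=> y /= hy; apply: chi2_quantile_le h1 _ => /=.
  by apply: le_trans hy; rewrite lee_fin; lra.
- apply: le_trans (chi2_quantile_le h5 h3) _; rewrite -lerBlDr.
  apply: le_trans (chi2_quantile_ge h4 h2); rewrite le_eqVlt; apply/orP; left.
  by apply/eqP; ring.
- exact: chi2_prob_lt_quantile h1 h4.
- by have := chi2_prob_gt_quantile h3; rewrite opprB addrCA subrr addr0.
Qed.

End chi2_quantiles.

(** * Independence *)

Section independence_theory.
Context d (T : measurableType d) (R : realType) (P : probability T R).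
Implicit Types F G : set_system T.

Lemma indep2C F G : indep2 P F G -> indep2 P G F.
Proof. by move=> FG A B GA FB; rewrite setIC FG// muleC. Qed.

Lemma indep2S F G F' G' : F' `<=` F -> G' `<=` G -> indep2 P F G ->
  indep2 P F' G'.
Proof. by move=> FF GG FG A B /FF FA /GG GB; exact: FG. Qed.

Let indep2_sigmar F G : F `<=` measurable -> G `<=` measurable ->
  setI_closed G -> indep2 P F G -> indep2 P F <<s G >>.
Proof.
move=> Fm Gm GI FG A B FA.
have mA : measurable A by exact: Fm.
have sGm : <<s G >> `<=` measurable by apply: smallest_sub => //; exact: sigma_algebra_measurable.
apply: (@dynkin_induction _ (g_sigma_algebraType G) G
  (fun B => P (A `&` B) = (P A * P B)%E)) => //.
- by rewrite setIT probability_setT mule1.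
- by move=> C GC; exact: FG.
- move=> C mC0 AC; have mC : measurable (C : set T) := sGm _ mC0.
  rewrite probability_setC// muleBr ?fin_num_measure// mule1 -AC.
  by rewrite -setDE measureD// -ge0_fin_numE ?measure_ge0// fin_num_measure.
- move=> E mE tE AE.
  have mE' n : measurable (E n : set T) by exact: sGm (mE n).
  rewrite setI_bigcupr !measure_bigcup//; last 2 first.
  + by move=> i _; exact: measurableI.
  + exact: trivIset_setIl.
  rewrite -(fineK (fin_num_measure P A mA)) -nneseriesZl; last by move=> i _; exact: measure_ge0.
  by apply: eq_eseriesr => i _; rewrite fineK ?fin_num_measure//; exact: AE.
Qed.

Lemma indep2_sigma F G : F `<=` measurable -> G `<=` measurable ->
  setI_closed F -> setI_closed G -> indep2 P F G ->
  indep2 P <<s F >> <<s G >>.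
Proof.
move=> Fm Gm FI GI FG; apply/indep2C/indep2_sigmar => //.
  by apply: smallest_sub => //; exact: sigma_algebra_measurable.
by apply/indep2C/indep2_sigmar.
Qed.

Section grouping.
Context (I : finType) (F : I -> set_system T).
Hypotheses (Fm : forall i, F i `<=` measurable) (FI : forall i, setI_closed (F i))
  (FT : forall i, F i setT).

(** A subfamily is padded with full sets, which belong to every F i. *)
Lemma mutual_indepT :
  (forall A : I -> set T, (forall i, F i (A i)) ->
    P (\bigcap_i A i) = (\prod_i fine (P (A i)))%:E) -> mutual_indep P F.
Proof.
move=> H J A FA; pose A' i := if i \in J then A i else setT.
have FA' i : F i (A' i) by rewrite /A'; case: ifP => // /FA.
have := H A' FA'.
have -> : \bigcap_i A' i = \bigcap_(i in [set` J]) A i.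
  apply/seteqP; split => t h i.
    by move=> /= iJ; have := h i Logic.I; rewrite /A' iJ.
  by move=> _; rewrite /A'; case: ifPn => // iJ; exact: h.
move=> ->; congr _%:E; rewrite [RHS]big_mkcond/=; apply: eq_bigr => i _.
by rewrite /A'; case: ifPn => // _; rewrite probability_setT.
Qed.

Hypothesis FP : mutual_indep P F.

(** The union of the F i is not closed under intersection; these rectangles are, and they contain
    that union. *)
Let Pi (J : {set I}) : set_system T :=
  [set \bigcap_(i in [set` J]) A i | A in [set A : I -> set T | forall i, F i (A i)]].

Let PiI J : setI_closed (Pi J).
Proof.
move=> _ _ [A FA <-] [B FB <-]; exists (fun i => A i `&` B i).
  by move=> i; exact: FI.
by rewrite bigcapI.
Qed.

Let Pim J : Pi J `<=` measurable.
Proof.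
move=> _ [A FA <-]; apply: fin_bigcap_measurable => // i _.
exact/Fm/FA.
Qed.

Let subPi (J : {set I}) : \bigcup_(i in [set` J]) F i `<=` Pi J.
Proof.
move=> A [i iJ FA]; exists (fun j => if j == i then A else setT).
  by move=> j; case: eqP => // ->.
apply/seteqP; split => t.
  by move=> /(_ i iJ); rewrite eqxx.
by move=> At j _; case: eqP.
Qed.

Lemma indep2_group (J1 J2 : {set I}) : (forall i, i \in J1 -> i \notin J2) ->
  indep2 P <<s \bigcup_(i in [set` J1]) F i >> <<s \bigcup_(i in [set` J2]) F i >>.
Proof.
move=> J12.
have J21 i : i \in J2 -> (i \in J1) = false.
  by move=> iJ; apply/negP => /J12; rewrite iJ.
apply: (@indep2S <<s Pi J1 >> <<s Pi J2 >>); try exact: sub_smallest2r.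
apply: indep2_sigma => //.
move=> _ _ [A FA <-] [B FB <-].
rewrite (FP (fun i _ => FA i)) (FP (fun i _ => FB i)) -EFinM.
pose E i := if i \in J1 then A i else B i.
transitivity (P (\bigcap_(i in [set` (J1 :|: J2)%SET]) E i)).
  congr (P _); apply/seteqP; split => t.
    move=> [h1 h2] i /=; rewrite inE /E; case: ifPn => [iJ _|iJ /= iJ2]; first exact: h1.
    exact: h2.
  move=> h; split=> i /= iJ.
    by have := h i; rewrite /= inE iJ /E iJ; apply.
  by have := h i; rewrite /= inE iJ orbT /E J21//; apply.
have FE i : i \in (J1 :|: J2)%SET -> F i (E i) by rewrite /E; case: ifP.
rewrite (FP FE) (eq_bigl [in [predU J1 & J2]]); last by move=> i; rewrite !inE.
rewrite bigU/=; last first.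
  by rewrite disjoint_subset; apply/fintype.subsetP => i /J12.
congr (_ * _)%:E; apply: eq_bigr => i iJ; rewrite /E ?iJ//.
by rewrite J21.
Qed.

End grouping.

(** This replaces conditional expectation: under independence the joint law is a product, so U can
    be frozen while V is integrated out. *)
Lemma ge0_integral_indep d1 d2 (T1 : measurableType d1) (T2 : measurableType d2)
    (U : T -> T1) (V : T -> T2) (f : T1 * T2 -> \bar R) :
  measurable_fun setT U -> measurable_fun setT V ->
  (forall A B, measurable A -> measurable B ->
    P (U @^-1` A `&` V @^-1` B) = (P (U @^-1` A) * P (V @^-1` B))%E) ->
  measurable_fun setT f -> (forall z, 0 <= f z)%E ->
  (\int[P]_t f (U t, V t) = \int[P]_t1 \int[P]_t2 f (U t1, V t2))%E.
Proof.
move=> mU mV UV mf f0.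
pose mu1 : probability T1 R := distribution P (mfun_Sub (mem_set mU)).
pose mu2 : probability T2 R := distribution P (mfun_Sub (mem_set mV)).
have mUV : measurable_fun setT (fun t => (U t, V t)) by exact: measurable_fun_pair.
pose nu : probability (T1 * T2)%type R := distribution P (mfun_Sub (mem_set mUV)).
transitivity (\int[nu]_z f z)%E.
  by rewrite ge0_integral_distribution.
transitivity (\int[mu1 \x mu2]_z f z)%E.
  apply: eq_measure_integral => A mA _; apply/esym.
  apply: (@product_measure_unique _ _ _ _ _ mu1 mu2 nu) => // B C mB mC.
rewrite fubini_tonelli1// ge0_integral_distribution//; last 2 first.
- exact: measurable_fun_fubini_tonelli_F.
- by move=> x; exact: integral_ge0.
apply: eq_integral => t _; rewrite /= /fubini_F ge0_integral_distribution//.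
by apply: measurableT_comp mf _; exact: measurable_pair1.
Qed.

End independence_theory.

Section preimage_systems.
Context d (T : measurableType d) (R : realType).

Definition preimages (Y : T -> R) : set_system T :=
  preimage_set_system setT Y measurable.

Lemma preimagesE (Y : T -> R) (B : set R) : measurable B -> preimages Y (Y @^-1` B).
Proof. by move=> mB; exists B => //; rewrite setTI. Qed.

Lemma preimages_measurable (Y : T -> R) : measurable_fun setT Y ->
  preimages Y `<=` measurable.
Proof. by move=> mY _ [B mB <-]; exact: mY. Qed.

Lemma preimagesI (Y : T -> R) : setI_closed (preimages Y).
Proof.
move=> _ _ [A mA <-] [B mB <-]; exists (A `&` B); first exact: measurableI.
by rewrite setIACA setIid.
Qed.

Lemma preimagesT (Y : T -> R) : preimages Y setT.
Proof. by exists setT => //; rewrite setTI preimage_setT. Qed.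

End preimage_systems.

Lemma measurable_sum_in d (T : measurableType d) (R : realType) (I : eqType)
    (r : seq I) (h : I -> T -> R) :
  (forall i, i \in r -> measurable_fun setT (h i)) ->
  measurable_fun setT (fun t => \sum_(i <- r) h i t).
Proof.
elim: r => [|i r IH] hm.
  by under eq_fun do rewrite big_nil; exact: measurable_cst.
under eq_fun do rewrite big_cons.
apply: measurable_funD; first by apply: hm; rewrite inE eqxx.
by apply: IH => j jr; apply: hm; rewrite inE jr orbT.
Qed.

Section generated.
Context d (T : measurableType d) (R : realType) (C : finType) (Y : C -> T -> R).

Definition sigma_on (J : {set C}) : set_system T :=
  \bigcup_(c in [set` J]) preimages (Y c).

(** The same set T with the sigma-algebra of the coordinates in J: depending only on these
    coordinates becomes plain measurability, provable by the usual closure rules. *)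
Definition sigma_onType (J : {set C}) := g_sigma_algebraType (sigma_on J).

Lemma measurable_sigma_onType (J : {set C}) c : c \in J ->
  measurable_fun (setT : set (sigma_onType J)) (Y c).
Proof.
move=> cJ _ B mB; rewrite setTI; apply: sub_gen_smallest.
by exists c => //; exact: preimagesE.
Qed.

Lemma measurable_sum_sigma_onType (J : {set C}) (r : seq C) (Q : pred C) (a : C -> R) :
  (forall c, c \in r -> Q c -> c \in J) ->
  measurable_fun (setT : set (sigma_onType J)) (fun t => \sum_(c <- r | Q c) a c * Y c t).
Proof.
move=> rJ.
rewrite (_ : (fun t => _) = (fun t => \sum_(c <- r) (if Q c then a c * Y c t else 0))); last first.
  by apply/funext => t; rewrite big_mkcond.
apply: measurable_sum_in => c cr; have [Qc|_] := boolP (Q c); last exact: measurable_cst.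
apply: measurable_funM; first exact: measurable_cst.
by apply: measurable_sigma_onType; exact: rJ.
Qed.

Lemma sigma_onType_measurable (J : {set C}) :
  (forall c, measurable_fun setT (Y c)) ->
  <<s sigma_on J >> `<=` (measurable : set (set T)).
Proof.
move=> mY; apply: smallest_sub; first exact: sigma_algebra_measurable.
by move=> A [c cJ]; exact: preimages_measurable.
Qed.

Lemma measurable_sub_sigma (J : {set C}) d' (T' : measurableType d') (f : T -> T') :
  (forall c, measurable_fun setT (Y c)) ->
  measurable_fun (setT : set (sigma_onType J)) f -> measurable_fun setT f.
Proof.
move=> mY mf _ B mB; rewrite setTI; apply: (@sigma_onType_measurable J mY).
by have := mf measurableT B mB; rewrite setTI.
Qed.

End generated.

(** * Linear and quadratic forms in independent standard Gaussians *)

Section iid_gauss.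
Context d (T : measurableType d) (R : realType) (P : probability T R).
Context (C : finType) (Y : C -> T -> R).
Local Notation gauss := (@normal_prob R 0 1).

Definition iid_gauss : Prop :=
  [/\ forall c, measurable_fun setT (Y c),
      mutual_indep P (fun c => preimages (Y c)) &
      forall c (B : set R), measurable B -> P (Y c @^-1` B) = gauss B].

Hypothesis iidY : iid_gauss.

Let mY c : measurable_fun setT (Y c). Proof. by case: iidY. Qed.

Lemma indep2_sigma_on (J1 J2 : {set C}) : (forall c, c \in J1 -> c \notin J2) ->
  indep2 P <<s sigma_on Y J1 >> <<s sigma_on Y J2 >>.
Proof.
move=> J12; case: iidY => _ iY _.
apply: indep2_group => //.
- by move=> c; exact: preimages_measurable.
- by move=> c; exact: preimagesI.
- by move=> c; exact: preimagesT.
Qed.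

(** One convolution step: it drives the inductions of [linE] and [chi2_rows], which peel off one
    coordinate or one group at a time. *)
Lemma law_of_indep (mu nu : probability (measurableTypeR R) R) (J1 J2 : {set C})
    (U V : T -> R) (g : R * R -> R) (B : set R) :
  (forall c, c \in J1 -> c \notin J2) ->
  measurable_fun (setT : set (sigma_onType Y J1)) U ->
  measurable_fun (setT : set (sigma_onType Y J2)) V ->
  (forall A, measurable A -> P (U @^-1` A) = mu A) ->
  (forall A, measurable A -> P (V @^-1` A) = nu A) ->
  measurable_fun setT g -> measurable B ->
  P ((fun t => g (U t, V t)) @^-1` B) = (\int[mu]_x nu [set y | B (g (x, y))])%E.
Proof.
move=> J12 mU mV Umu Vnu mg mB.
have mU' := measurable_sub_sigma mY mU; have mV' := measurable_sub_sigma mY mV.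
pose U' : T -> measurableTypeR R := U.
pose V' : T -> measurableTypeR R := V.
have mU'' : measurable_fun setT U' by exact: mU'.
have mV'' : measurable_fun setT V' by exact: mV'.
have mUV : measurable_fun setT (fun t => (U' t, V' t)) by exact: measurable_fun_pair.
pose la : probability (measurableTypeR R * measurableTypeR R)%type R :=
  distribution P (mfun_Sub (mem_set mUV)).
have mgB : measurable (g @^-1` B) by rewrite -[X in measurable X]setTI; exact: mg.
transitivity (la (g @^-1` B)); first by [].
rewrite -(@product_measure_unique _ _ _ _ _ mu nu la)//.
- apply: eq_integral => x _ /=; congr (nu _).
  by apply/seteqP; split => y; rewrite /xsection/= ?inE// => /set_mem.
- move=> A A' mA mA'.
  transitivity (P (U @^-1` A) * P (V @^-1` A'))%E; last by rewrite Umu// Vnu.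
  apply: (indep2_sigma_on J12).
    by have := mU measurableT A mA; rewrite setTI.
  by have := mV measurableT A' mA'; rewrite setTI.
Qed.

Let lin (a : C -> R) (r : seq C) (t : T) : R := \sum_(c <- r) a c * Y c t.

(** Induction with [gauss_conv]. The law is described as that of a rescaled standard Gaussian, so
    that zero variance, as for the empty sum, is allowed. *)
Let linE (a : C -> R) (r : seq C) (B : set R) : uniq r -> measurable B ->
  P (lin a r @^-1` B) =
  gauss ((fun z : R => Num.sqrt (\sum_(c <- r) a c ^+ 2) * z) @^-1` B).
Proof.
elim: r B => [|c r IH] B /=.
  move=> _ mB.
  have -> : lin a [::] = cst 0 by apply/funext => t; rewrite /lin big_nil.
  have -> : (fun z : R => Num.sqrt (\sum_(c <- [::]) a c ^+ 2) * z) = cst 0.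
    by apply/funext => z; rewrite big_nil sqrtr0 mul0r.
  by rewrite !preimage_cst; case: ifPn => _; rewrite ?probability_setT ?measure0.
move=> /andP[cr ur] mB.
set s := Num.sqrt (\sum_(c <- r) a c ^+ 2).
have s0 : 0 <= s by exact: sqrtr_ge0.
pose sc : measurableTypeR R -> measurableTypeR R := *%R s.
have ms : measurable_fun setT sc.
  suff : measurable_fun (setT : set R) (fun z : R => s * z) by [].
  exact: measurable_funM.
pose mu : probability (measurableTypeR R) R := distribution gauss (mfun_Sub (mem_set ms)).
pose g (z : R * R) : R := z.1 + a c * z.2.
have mg : measurable_fun setT g by apply: measurable_funD => //; exact: measurable_funM.
have -> : lin a (c :: r) = (fun t => g (lin a r t, Y c t)).
  by apply/funext => t; rewrite /lin big_cons addrC.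
rewrite (@law_of_indep mu gauss [set c' in r]%SET [set c]%SET); last first.
- exact: mB.
- exact: mg.
- by case: iidY => _ _; apply.
- by move=> A mA; rewrite IH.
- by apply: measurable_sigma_onType; rewrite inE.
- by apply: measurable_sum_sigma_onType => c' c'r _; rewrite inE.
- move=> c'; rewrite !inE => c'r; apply: contraNN cr => /eqP <- //.
rewrite big_cons addrC -[in RHS](sqr_sqrtr (_ : 0 <= \sum_(j <- r) a j ^+ 2)); last first.
  by apply: sumr_ge0 => i _; exact: sqr_ge0.
rewrite -/s -gauss_conv// /mu ge0_integral_distribution//.
have -> : (fun x : measurableTypeR R => gauss [set y | B (g (x, y))]) =
      gauss \o xsection [set z : R * R | B (g z)].
  apply/funext => x /=; congr (normal_prob 0 1 _).
  by apply/seteqP; split => y; rewrite /xsection/= ?inE// => /mem_set; rewrite inE.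
apply: measurable_fun_xsection.
by rewrite -[X in measurable X]setTI; exact: mg.
Qed.

Lemma gauss_lin (a : C -> R) (Q : pred C) (B : set R) : measurable B ->
  \sum_(c | Q c) a c ^+ 2 = 1 ->
  P ((fun t => \sum_(c | Q c) a c * Y c t) @^-1` B) = gauss B.
Proof.
move=> mB a1.
have := @linE a (enum Q) B (enum_uniq _) mB.
have -> : lin a (enum Q) = (fun t => \sum_(c | Q c) a c * Y c t).
  by apply/funext => t; rewrite /lin big_enum.
move=> ->; rewrite big_enum/= a1 sqrtr1; congr (gauss _).
by apply/seteqP; split => y /=; rewrite mul1r.
Qed.

(** Each fibre of [grp] carries a linear form of unit variance, and distinct fibres share no
    coordinate. The induction mirrors the recursion in [chi2_prob]. *)
Lemma chi2_rows (I : finType) (grp : C -> I) (a : C -> R) (r : seq I) (B : set R) :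
  uniq r -> (forall i, i \in r -> \sum_(c | grp c == i) a c ^+ 2 = 1) ->
  measurable B ->
  P ((fun t => \sum_(i <- r) (\sum_(c | grp c == i) a c * Y c t) ^+ 2) @^-1` B) =
  chi2_prob (size r) B.
Proof.
elim: r B => [|i r IH] B /=.
  move=> _ _ mB.
  have -> : (fun t => \sum_(i <- [::]) (\sum_(c | grp c == i) a c * Y c t) ^+ 2) = cst 0.
    by apply/funext => t; rewrite big_nil.
  rewrite preimage_cst/= diracE; case: ifPn => _; last exact: measure0.
  exact: probability_setT.
move=> /andP[ir ur] ha mB.
have [mu [muE _ _]] := chi2_law R (size r).
pose g (z : R * R) : R := z.2 + z.1 ^+ 2.
have mg : measurable_fun setT g by apply: measurable_funD => //; exact: measurable_funX.
have -> : (fun t => \sum_(j <- i :: r) (\sum_(c | grp c == j) a c * Y c t) ^+ 2) =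
    (fun t => g (\sum_(c | grp c == i) a c * Y c t,
                 \sum_(j <- r) (\sum_(c | grp c == j) a c * Y c t) ^+ 2)).
  by apply/funext => t; rewrite big_cons addrC.
rewrite (@law_of_indep gauss mu [set c | grp c == i]%SET [set c | grp c \in r]%SET); last first.
- exact: mB.
- exact: mg.
- move=> A mA; rewrite -muE// IH// => j jr; apply: ha; by rewrite inE jr orbT.
- by move=> A mA; apply: gauss_lin => //; apply: ha; rewrite inE eqxx.
- apply: measurable_sum_in => j jr; apply: measurable_funX.
  by apply: measurable_sum_sigma_onType => c _ /eqP cj; rewrite inE cj.
- by apply: measurable_sum_sigma_onType => c _; rewrite inE.
- by move=> c; rewrite !inE => /eqP ->.
apply: eq_integral => x _; rewrite -muE//.
have := measurable_affine_preimage (x ^+ 2) 1 mB.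
by congr measurable; apply/seteqP; split => y /=; rewrite mul1r addrC.
Qed.

End iid_gauss.

(** * Reduction of the linear model to independent standard Gaussians *)

Section posdef_sqrt.
Context (R : realType).

Lemma sqnorm_ge0 n (v : 'cV[R]_n) : 0 <= sqnorm v.
Proof. by apply: sumr_ge0 => i _; exact: sqr_ge0. Qed.

Lemma sqnormE n (v : 'cV[R]_n) : (v^T *m v) 0 0 = sqnorm v.
Proof. by rewrite mxE; apply: eq_bigr => i _; rewrite mxE expr2. Qed.

(** (L + a)(L - a) = 0, and L + a is injective because L is positive definite. This identifies the
    unspecified square root in [mvnormal] for the scalar covariances of [Theta0]. *)
Lemma posdef_sqrt n (a : R) (L : 'M[R]_n) : 0 <= a -> posdef L ->
  L *m L = (a ^+ 2)%:M -> L = a%:M.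
Proof.
move=> a0 [_ Lpos] LL.
have key (u : 'cV[R]_n) : L *m u + a *: u = 0 -> u = 0.
  move=> h; apply/eqP/negPn/negP => u0; have := Lpos u u0.
  have -> : u^T *m L *m u = - (a *: (u^T *m u)).
    by rewrite -mulmxA (_ : L *m u = - (a *: u)) ?mulmxN ?scalemxAr//; apply/eqP; rewrite -addr_eq0 h.
  rewrite mxE [X in - X]mxE sqnormE oppr_gt0 ltNge.
  by rewrite mulr_ge0 ?sqnorm_ge0.
apply/matrixP => i j; apply/eqP; rewrite -subr_eq0; apply/eqP.
have : col j (L - a%:M) = 0.
  apply: key; rewrite !colE scalemxAl mulmxA -mulmxDl.
  have -> : L *m (L - a%:M) + a *: (L - a%:M) = 0; last by rewrite mul0mx.
  rewrite mulmxBr LL mul_mx_scalar scalerBr scale_scalar_mx -expr2.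
  by rewrite subrKA subrr.
by move=> /matrixP /(_ i 0); rewrite !mxE.
Qed.

End posdef_sqrt.

Lemma g_sigma_bigcap (T : pointedType) (I : finType) (G : set_system T)
    (A : I -> set T) : (forall i, <<s G >> (A i)) -> <<s G >> (\bigcap_i A i).
Proof.
move=> GA.
apply: (@fin_bigcap_measurable _ (g_sigma_algebraType G) I setT A) => // i _.
exact: GA.
Qed.

Lemma sigma_of_preimage (R : realType) (T I : Type) (f : I -> T -> R) i (B : set R) :
  measurable B -> sigma_of f (f i @^-1` B).
Proof.
move=> mB; apply: sub_gen_smallest; exists i => //.
by exists B => //; rewrite setTI.
Qed.

Lemma mutual_indep_all d (T : measurableType d) (R : realType) (P : probability T R)
    (I : finType) (F : I -> set_system T) (A : I -> set T) :
  mutual_indep P F -> (forall i, F i (A i)) ->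
  P (\bigcap_i A i) = (\prod_i fine (P (A i)))%:E.
Proof.
move=> FP FA; have := FP finset.setT A (fun i _ => FA i).
have -> : [set` finset.setT] = [set: I] by apply/seteqP; split => i //= _; rewrite inE.
by move=> ->; congr _%:E; apply: eq_bigl => i; rewrite inE.
Qed.

Section linear_model_iid.
Context d (T : measurableType d) (R : realType) (P : probability T R) (n p : nat).

Definition zvar (b : 'cV[R]_p) (sigma : R) (z : sample R n p)
    (c : 'I_n * 'I_p + 'I_n) : R :=
  match c with
  | inl ij => z.1 ij.1 ij.2
  | inr i => sigma^-1 * residual z b i 0
  end.

(** Mutual independence is assembled from three levels: design against noise, rows of the design,
    and coordinates within a row or within the noise. *)
Lemma linear_model_iid (th : param R p) (sigma0 : R) (k : nat)
    (Z : T -> sample R n p) : 0 < sigma0 -> Theta0 sigma0 k th ->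
  linear_model P th Z ->
  iid_gauss P (fun c t => zvar (coef th) sigma0 (Z t) c).
Proof.
move=> s0 [_ cov noi] [mZ rows rowg epsg Xeps].
have rowG i : std_gaussian P (fun t => (row i (Z t).1)^T).
  have [L [g [Lp LL gg gE]]] := rowg i.
  have L1 : L = 1%:M by apply: posdef_sqrt => //; rewrite LL cov expr1n.
  suff -> : (fun t => (row i (Z t).1)^T) = g by [].
  by apply/funext => t; rewrite gE L1 mul1mx.
have epsG : std_gaussian P (fun t => sigma0^-1 *: residual (Z t) (coef th)).
  have [L [g [Lp LL gg gE]]] := epsg.
  have L1 : L = sigma0%:M by apply: posdef_sqrt (ltW s0) Lp _; rewrite LL noi.
  suff -> : (fun t => sigma0^-1 *: residual (Z t) (coef th)) = g by [].
  by apply/funext => t; rewrite gE L1 mul_scalar_mx scalerA mulVf ?gt_eqF// scale1r.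
set Y := fun c t => _.
have YX i j : Y (inl (i, j)) = fun t => (row i (Z t).1)^T j 0.
  by apply/funext => t; rewrite /Y/= !mxE.
have YE i : Y (inr i) = fun t => (sigma0^-1 *: residual (Z t) (coef th)) i 0.
  by apply/funext => t; rewrite /Y/= !mxE.
have mY c : measurable_fun setT (Y c).
  case: c => [[i j]|i].
    by rewrite YX; have [h _ _] := rowG i; exact: h.
  by rewrite YE; have [h _ _] := epsG; exact: h.
split => //; last first.
- move=> [[i j]|i] B mB; first by rewrite YX; have [_ _ h] := rowG i; exact: h.
  by rewrite YE; have [_ _ h] := epsG; exact: h.
apply: mutual_indepT; first by move=> c; exact: preimagesT.
move=> A FA.
pose AX i := \bigcap_j A (inl (i, j)).
pose AE := \bigcap_i A (inr i).
have -> : \bigcap_c A c = (\bigcap_i AX i) `&` AE.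
  apply/seteqP; split => t.
    by move=> h; split => [i _ j _|i _]; exact: h.
  by move=> [h1 h2] [[i j]|i] _; [exact: h1|exact: h2].
have sA c : exists2 B, measurable B & A c = Y c @^-1` B.
  by have [B mB <-] := FA c; exists B => //; rewrite setTI.
have rowX i : sigma_of (fun j t => (Z t).1 i j) (AX i).
  apply: g_sigma_bigcap => j; have [B mB ->] := sA (inl (i, j)).
  exact: (@sigma_of_preimage _ _ _ (fun j t => (Z t).1 i j) j B mB).
have EX : sigma_of (fun (ij : 'I_n * 'I_p) t => (Z t).1 ij.1 ij.2) (\bigcap_i AX i).
  apply: g_sigma_bigcap => i; apply: g_sigma_bigcap => j.
  have [B mB ->] := sA (inl (i, j)).
  exact: (@sigma_of_preimage _ _ _ (fun (ij : 'I_n * 'I_p) t => (Z t).1 ij.1 ij.2) (i, j) B mB).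
have EE : sigma_of (fun i t => residual (Z t) (coef th) i 0) AE.
  apply: g_sigma_bigcap => i; have [B mB ->] := sA (inr i).
  have := @sigma_of_preimage _ _ _ (fun i t => residual (Z t) (coef th) i 0) i _
    (measurable_affine_preimage 0 sigma0^-1 mB).
  by congr sigma_of; apply/seteqP; split => t /=; rewrite add0r.
rewrite (Xeps _ _ EX EE).
rewrite (mutual_indep_all rows rowX).
have PX i : P (AX i) = (\prod_j fine (P (A (inl (i, j)))))%:E.
  have [_ h _] := rowG i; apply: (mutual_indep_all h) => j.
  have [B mB ->] := sA (inl (i, j)); rewrite YX.
  exact: (@sigma_of_preimage _ _ _ (fun (_ : unit) t => (row i (Z t).1)^T j 0) tt B mB).
have PE : P AE = (\prod_i fine (P (A (inr i))))%:E.
  have [_ h _] := epsG; apply: (mutual_indep_all h) => i.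
  have [B mB ->] := sA (inr i); rewrite YE.
  exact: (@sigma_of_preimage _ _ _
    (fun (_ : unit) t => (sigma0^-1 *: residual (Z t) (coef th)) i 0) tt B mB).
rewrite PE -EFinM; congr _%:E; rewrite big_sumType/=; congr (_ * _).
transitivity (\prod_i \prod_j fine (P (A (inl (i, j))))).
  by apply: eq_bigr => i _; rewrite PX.
by rewrite pair_bigA; apply: eq_bigr => -[].
Qed.

End linear_model_iid.

(** * Deterministic bounds for the Lasso *)

Section maurey.
Context (R : realType) (n p : nat).
Implicit Types (X : 'M[R]_(n, p)) (h u v : 'cV[R]_p).

(** For a draw with weights w, x minus its mean is centred: the cross term with v vanishes and only
    the variance is added. *)
Let weighted_variance (I : finType) (w x : I -> R) (v : R) :
  \sum_i w i = 1 ->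
  \sum_i w i * (v + x i - \sum_j w j * x j) ^+ 2 =
  v ^+ 2 + \sum_i w i * x i ^+ 2 - (\sum_j w j * x j) ^+ 2.
Proof.
move=> w1; set m := \sum_j w j * x j.
transitivity (\sum_i (w i * (v - m) ^+ 2 + 2 * (v - m) * (w i * x i) + w i * x i ^+ 2)).
  by apply: eq_bigr => i _; ring.
by rewrite !big_split/= -mulr_suml -mulr_sumr w1 -/m; ring.
Qed.

Let sqnorm_variance m (I : finType) (w : I -> R) (x : I -> 'cV[R]_m) (v : 'cV[R]_m) :
  \sum_i w i = 1 ->
  \sum_i w i * sqnorm (v + x i - \sum_j w j *: x j) =
  sqnorm v + \sum_i w i * sqnorm (x i) - sqnorm (\sum_j w j *: x j).
Proof.
move=> w1; rewrite /sqnorm.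
have E c : (\sum_j w j *: x j) c 0 = \sum_j w j * x j c 0.
  by rewrite summxE; apply: eq_bigr => i _; rewrite mxE.
under eq_bigr do rewrite mulr_sumr.
rewrite exchange_big/=.
under [X in _ = _ + X - _]eq_bigr do rewrite mulr_sumr.
rewrite [X in _ = _ + X - _]exchange_big/= -big_split/= -sumrB.
apply: eq_bigr => c _; rewrite E -weighted_variance//.
by apply: eq_bigr => i _; rewrite !mxE E.
Qed.

Let exists_le_mean (I : finType) (w a : I -> R) (c : R) :
  (forall i, 0 <= w i) -> \sum_i w i = 1 -> \sum_i w i * a i <= c ->
  exists i, a i <= c.
Proof.
move=> w0 w1 ac; apply: contrapT => H.
have ca i : 0 < a i - c by rewrite subr_gt0 ltNge; apply/negP => ci; apply: H; exists i.
have T0 i : 0 <= w i * (a i - c) by rewrite mulr_ge0// ltW.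
have : \sum_i w i * (a i - c) == 0.
  rewrite eq_le sumr_ge0// andbT.
  under eq_bigr do rewrite mulrBr.
  by rewrite sumrB -mulr_suml w1 mul1r subr_le0.
rewrite psumr_eq0// => /allP W.
have : \sum_i w i = 0.
  apply: big1 => i _; have := W i (mem_index_enum _).
  by rewrite mulf_eq0 (gt_eqF (ca i)) orbF => /eqP.
by apply/eqP; rewrite w1 oner_eq0.
Qed.

Definition signed_unit (x : 'I_p * bool) : 'cV[R]_p :=
  (-1) ^+ x.2 *: delta_mx x.1 0.

Definition unit_sum (s : seq ('I_p * bool)) : 'cV[R]_p :=
  \sum_(x <- s) signed_unit x.

(* Maurey's empirical method, derandomised: the points are chosen greedily, each
   not exceeding the average over the next random draw. *)
Let greedy X (kappa d : R) (J : finType) (w : J -> R) (z : J -> 'I_p * bool) M u :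
  let q v := sqnorm (X *m v) - kappa * sqnorm v in
  let hbar := \sum_j w j *: signed_unit (z j) in
  0 <= kappa -> (forall j, 0 <= w j) -> \sum_j w j = 1 ->
  (forall j, sqnorm (X *m signed_unit (z j)) <= d) ->
  exists s : M.-tuple ('I_p * bool),
    q (u + unit_sum s) <= q (u + M%:R *: hbar) + M%:R * d.
Proof.
move=> q hbar k0 w0 w1 zd; elim: M u => [|M IH] u.
  by exists [tuple]; rewrite /unit_sum big_nil scale0r mul0r !addr0.
pose v := u + M.+1%:R *: hbar.
(* Replacing one copy of [hbar] by a random draw changes the mean of q by the variance of X e minus
   kappa times the variance of e. The first is at most d and the second only helps. *)
have [j hj] : exists j, q (v + signed_unit (z j) - hbar) <= q v + d.
  apply: (exists_le_mean w0 w1).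
  rewrite /q.
  under eq_bigr do rewrite mulrBr mulrCA.
  rewrite sumrB -mulr_sumr sqnorm_variance//.
  have EX : X *m hbar = \sum_j w j *: (X *m signed_unit (z j)).
    by rewrite mulmx_sumr; apply: eq_bigr => i _; rewrite scalemxAr.
  under eq_bigr do rewrite mulmxBr mulmxDr EX.
  rewrite sqnorm_variance//= -EX -/hbar.
  have S1 := sqnorm_variance (fun j => signed_unit (z j)) 0 w1.
  have S2 : 0 <= \sum_i w i * sqnorm (0 + signed_unit (z i) - hbar).
    by apply: sumr_ge0 => i _; rewrite mulr_ge0 ?sqnorm_ge0.
  rewrite S1 in S2; have S3 : sqnorm (0 : 'cV[R]_p) = 0.
    by rewrite /sqnorm big1// => i _; rewrite mxE expr0n.
  have S4 : \sum_i w i * sqnorm (X *m signed_unit (z i)) <= d.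
    rewrite -[leRHS]mul1r -w1 mulr_suml; apply: ler_sum => i _.
    by rewrite ler_wpM2l.
  have S5 := sqnorm_ge0 (X *m hbar).
  move: S2; rewrite S3 add0r -/hbar => S2.
  have := mulr_ge0 k0 S2.
  lra.
have [s hs] := IH (u + signed_unit (z j)).
exists [tuple of z j :: s]; rewrite /unit_sum big_cons addrA.
apply: le_trans hs _.
have -> : u + signed_unit (z j) + M%:R *: hbar = v + signed_unit (z j) - hbar.
  by rewrite /v -natr1 scalerDl scale1r; apply/matrixP => a b; rewrite !mxE; ring.
rewrite -[M.+1%:R]natr1 mulrDl mul1r.
have e1 : u + (M%:R + 1) *: hbar = v by rewrite /v natr1.
rewrite e1; lra.
Qed.

(** h / |h|_1 is a convex combination of signed unit vectors. Starting from u = 0, [greedy] gives a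
    sum s of M of them with 0 <= q(s) <= q(M h / |h|_1) + M d; multiply by (|h|_1 / M)^2. *)
Lemma restricted_eigenvalue X (kappa d : R) (M : nat) : (0 < M)%N -> 0 <= kappa ->
  (forall s : M.-tuple ('I_p * bool),
     kappa * sqnorm (unit_sum s) <= sqnorm (X *m unit_sum s)) ->
  (forall j, sqnorm (col j X) <= d) ->
  forall h, kappa * sqnorm h <= sqnorm (X *m h) + d / M%:R * (\sum_j `|h j 0|) ^+ 2.
Proof.
move=> M0 k0 Hs Hd h.
set L := \sum_j `|h j 0|.
have L0 : 0 <= L by exact: sumr_ge0.
have MR0 : 0 < M%:R :> R by rewrite ltr0n.
have [L00|Ln] := eqVneq L 0.
  have h0 : h = 0.
    apply/matrixP => i j; rewrite ord1 mxE; apply/eqP; rewrite -normr_eq0.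
    by move/eqP: L00; rewrite psumr_eq0// => /allP/(_ i (mem_index_enum _)).
  have S3 m : sqnorm (0 : 'cV[R]_m) = 0.
    by rewrite /sqnorm big1// => i _; rewrite mxE expr0n.
  by rewrite L00 h0 mulmx0 !S3 expr0n/= !mulr0 addr0.
have Lp : 0 < L by rewrite lt_neqAle eq_sym Ln.
pose z (j : 'I_p) := (j, h j 0 < 0).
pose w (j : 'I_p) := `|h j 0| / L.
have w1 : \sum_j w j = 1 by rewrite -mulr_suml divff.
have w0 j : 0 <= w j by rewrite divr_ge0.
have XD j : sqnorm (X *m signed_unit (z j)) <= d.
  apply: le_trans (Hd j); rewrite /signed_unit/= -scalemxAr -colE /sqnorm.
  by apply: ler_sum => i _; rewrite !mxE exprMn sqrr_sign mul1r.
have hb : \sum_j w j *: signed_unit (z j) = L^-1 *: h.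
  rewrite [in RHS](matrix_sum_delta h) scaler_sumr; apply: eq_bigr => j _.
  rewrite big_ord1 /signed_unit/w/= !scalerA mulrC mulrA [in RHS]mulrC; congr (_ * _ *: _).
  by rewrite [RHS]realEsign ?num_real.
have [s] := @greedy X kappa d _ w z M 0 k0 w0 w1 XD.
rewrite !add0r hb scalerA -scalemxAr.
have SZ m (a : R) (v : 'cV[R]_m) : sqnorm (a *: v) = a ^+ 2 * sqnorm v.
  by rewrite /sqnorm mulr_sumr; apply: eq_bigr => i _; rewrite mxE exprMn.
rewrite !SZ => hs.
have := Hs s; rewrite -subr_ge0 => h1; have {h1 hs} := le_trans h1 hs.
set a := sqnorm _; set b := sqnorm h => H.
have : 0 <= (M%:R / L) ^+ 2 * (a + d / M%:R * L ^+ 2 - kappa * b).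
  have -> : (M%:R / L) ^+ 2 * (a + d / M%:R * L ^+ 2 - kappa * b) =
    (M%:R / L) ^+ 2 * a - kappa * ((M%:R / L) ^+ 2 * b) + M%:R * d by field; rewrite !gt_eqF.
  by [].
by rewrite pmulr_rge0 ?exprn_gt0 ?divr_gt0// subr_ge0.
Qed.

End maurey.

(** * The basic inequality and the l2 error of the Lasso *)

Section lasso.
Context (R : realType).

(* T0, e, g stand for |y - X b|^2 / n, |eps|^2 / n, |X h|^2 / n; a1, one, x for
   |h_S|_1, |h|_1, |h|_2^2 with S the support of beta; W and Ws for the weighted
   l1-norms of h and h_S. *)
Let lasso_scalar (A sigma l N kk M lam T0 e a1 one g x W Ws : R) :
  0 < sigma -> 0 < A -> 2 <= A ^+ 2 -> 0 < l -> 0 < N -> 0 < M -> 0 <= kk ->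
  lam ^+ 2 = A ^+ 2 * (l / N) * sigma ^+ 2 -> 0 < lam ->
  N <= 16 * l * M -> 1024 * (2048 * (kk * l)) <= N ->
  T0 + lam * W <= e + 2 * lam * Ws -> Ws <= 2 * a1 -> one / 4 <= W ->
  0 <= T0 -> 0 <= e -> e <= 4 * sigma ^+ 2 -> 0 <= a1 -> 0 <= one -> 0 <= x ->
  a1 ^+ 2 <= kk * x -> g <= 2 * e + 2 * T0 ->
  x / 16 <= g + 4 / M * one ^+ 2 ->
  x <= 32 * (128 * 129 + A ^+ 2) * sigma ^+ 2.
Proof.
move=> s0 A0 A2 l0 N0 M0 kk0 lam2 lam0 NM kl basic Wsa oneW T00 e0 e4 a10 one0 x0 ax gT RE.
have lN : 0 < l / N by rewrite divr_gt0.
have klN : kk * (l / N) <= (1024^-1 * 2048^-1).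
  by rewrite mulrA ler_pdivrMr//; lra.
have M1 : M^-1 <= 16 * (l / N).
  rewrite mulrA ler_pdivlMr// mulrC ler_pdivrMr//; lra.
have lamWs : lam * Ws <= lam * (2 * a1) by rewrite ler_pM2l.
have lamW : lam * (one / 4) <= lam * W by rewrite ler_pM2l.
have s2 : 0 < sigma ^+ 2 by rewrite exprn_gt0.
have T0le : T0 <= 4 * sigma ^+ 2 + 4 * (lam * a1).
  have : 0 <= lam * W by apply: le_trans lamW; rewrite mulr_ge0 ?(ltW lam0)// divr_ge0.
  lra.
have onele : lam * one <= 16 * sigma ^+ 2 + 16 * (lam * a1) by lra.
have la2 : (lam * a1) ^+ 2 <= (A ^+ 2 * sigma ^+ 2 * (1024^-1 * 2048^-1)) * x.
  rewrite exprMn lam2.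
  apply: (@le_trans _ _ (A ^+ 2 * (l / N) * sigma ^+ 2 * (kk * x))).
    apply: ler_wpM2l ax; apply: mulr_ge0 (sqr_ge0 _).
    exact: mulr_ge0 (sqr_ge0 _) (ltW lN).
  have -> : A ^+ 2 * (l / N) * sigma ^+ 2 * (kk * x) =
     (A ^+ 2 * sigma ^+ 2 * x) * (kk * (l / N)) by ring.
  have -> : A ^+ 2 * sigma ^+ 2 * (1024^-1 * 2048^-1) * x =
     (A ^+ 2 * sigma ^+ 2 * x) * (1024^-1 * 2048^-1) by ring.
  apply: ler_wpM2l klN; apply: mulr_ge0 x0.
  exact: mulr_ge0 (sqr_ge0 _) (sqr_ge0 _).
have q0 : 0 <= lam * a1 by rewrite mulr_ge0// ltW.
(* Arithmetic-geometric mean inequality (u + v)^2 >= 4 u v with u = x / 64 and v = A^2 sigma^2 /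
   2048; the constant 1024 * 2048 is exactly what [la2] needs to supply 4 u v. *)
have AM : 8 * (lam * a1) <= x / 64 + A ^+ 2 * sigma ^+ 2 / 2048.
  have As0 : 0 <= A ^+ 2 * sigma ^+ 2 := mulr_ge0 (sqr_ge0 _) (sqr_ge0 _).
  move: la2 q0 As0; move: (lam * a1) (A ^+ 2 * sigma ^+ 2) => q S la2 q0 S0.
  have : 64 * q ^+ 2 <= 4 * (x / 64) * (S / 2048).
    apply: (@le_trans _ _ (64 * (S * (1024^-1 * 2048^-1) * x))).
      by apply: ler_wpM2l la2; exact: ler0n.
    by rewrite le_eqVlt; apply/orP; left; apply/eqP; field.
  have : 0 <= x / 64 := divr_ge0 x0 (ler0n _ _).
  have : 0 <= S / 2048 := divr_ge0 S0 (ler0n _ _).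
  move: (x / 64) (S / 2048) => u v v0 u0 quv.
  rewrite -(@ler_pXn2r _ 2) ?nnegrE ?mulr_ge0 ?addr_ge0//.
  have -> : (8 * q) ^+ 2 = 64 * q ^+ 2 by ring.
  have -> : (u + v) ^+ 2 = (u - v) ^+ 2 + 4 * u * v by ring.
  by rewrite (le_trans quv)// lerDr sqr_ge0.
(* Multiplied by A^2 sigma^2, the left side is (lam * one)^2, which [onele] controls. The bound A^2
   >= 2 turns 512 sigma^4 into 256 A^2 sigma^4. *)
have one2 : (l / N) * one ^+ 2 <= 256 * sigma ^+ 2 + x / 4096.
  have h1 : (lam * one) ^+ 2 <= 512 * (sigma ^+ 2) ^+ 2 + 512 * (lam * a1) ^+ 2.
    apply: (@le_trans _ _ ((16 * sigma ^+ 2 + 16 * (lam * a1)) ^+ 2)).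
      by apply: lerXn2r onele; rewrite nnegrE ?addr_ge0 ?mulr_ge0 ?(ltW lam0)// ltW.
    have -> : 512 * (sigma ^+ 2) ^+ 2 + 512 * (lam * a1) ^+ 2 =
      (16 * sigma ^+ 2 + 16 * (lam * a1)) ^+ 2 + 256 * (sigma ^+ 2 - lam * a1) ^+ 2 by ring.
    by rewrite lerDl; exact: mulr_ge0 (ler0n _ _) (sqr_ge0 _).
  have A2s : 0 < A ^+ 2 * sigma ^+ 2 by rewrite mulr_gt0// exprn_gt0.
  rewrite -(ler_pM2l A2s).
  have -> : A ^+ 2 * sigma ^+ 2 * ((l / N) * one ^+ 2) = (lam * one) ^+ 2.
    by rewrite exprMn lam2; ring.
  apply: le_trans h1 _.
  have -> : A ^+ 2 * sigma ^+ 2 * (256 * sigma ^+ 2 + x / 4096) =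
    256 * ((sigma ^+ 2) ^+ 2 * A ^+ 2) + 512 * (A ^+ 2 * sigma ^+ 2 * (1024^-1 * 2048^-1) * x).
    by field.
  apply: lerD; last by apply: ler_wpM2l la2; exact: ler0n.
  have : (sigma ^+ 2) ^+ 2 * 2 <= (sigma ^+ 2) ^+ 2 * A ^+ 2.
    by rewrite ler_wpM2l// sqr_ge0.
  move: ((sigma ^+ 2) ^+ 2) (_ * A ^+ 2) => u v; clear; lra.
have oneM : 4 / M * one ^+ 2 <= 64 * ((l / N) * one ^+ 2).
  have h := ler_wpM2r (sqr_ge0 one) M1.
  have -> : 4 / M * one ^+ 2 = 4 * (M^-1 * one ^+ 2) by ring.
  have -> : 64 * ((l / N) * one ^+ 2) = 4 * (16 * (l / N) * one ^+ 2) by ring.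
  by rewrite ler_pM2l.
have AS0 : 0 <= A ^+ 2 * sigma ^+ 2 := mulr_ge0 (sqr_ge0 _) (sqr_ge0 _).
have -> : 32 * (128 * 129 + A ^+ 2) * sigma ^+ 2 =
  32 * (128 * 129 * sigma ^+ 2 + A ^+ 2 * sigma ^+ 2) by ring.
have {s2} s2 := ltW s2.
(* Of x / 16 on the left, the prediction error and the Maurey error each consume x / 64; the
   remaining x / 32 explains the factor 32. *)
clear -AM one2 RE gT T0le e4 oneM AS0 s2.
lra.
Qed.

Let sqr_sum_le (I : finType) (S : {set I}) (x : I -> R) :
  (\sum_(j in S) x j) ^+ 2 <= #|S|%:R * \sum_(j in S) x j ^+ 2.
Proof.
set a := \sum_(j in S) x j; set b := \sum_(j in S) x j ^+ 2.
have [S0|S0] := posnP #|S|.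
  by rewrite /a (cards0_eq S0) big_set0 expr0n cards0 mul0r.
have SR0 : 0 < #|S|%:R :> R by rewrite ltr0n.
have : 0 <= \sum_(j in S) (#|S|%:R * x j - a) ^+ 2 by apply: sumr_ge0 => j _; exact: sqr_ge0.
have -> : \sum_(j in S) (#|S|%:R * x j - a) ^+ 2 = #|S|%:R * (#|S|%:R * b - a ^+ 2).
  transitivity (\sum_(j in S) (#|S|%:R ^+ 2 * x j ^+ 2 - 2 * #|S|%:R * a * x j + a ^+ 2)).
    by apply: eq_bigr => j _; ring.
  rewrite big_split sumrB -!mulr_sumr sumr_const -/a -/b -mulr_natr/=; ring.
by rewrite pmulr_rge0// subr_ge0.
Qed.

(** The two-sided column bound puts the penalty weights between 1/4 and 2, so weighted and plain
    l1-norms are comparable. The residual of b is never expanded: |X h|^2 <= 2 |eps|^2 + 2 |y - X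
    b|^2 avoids any correlation between design and noise. *)
Lemma lasso_error (n p k M : nat) (A sigma : R) (z : sample R n p)
    (beta b : 'cV[R]_p) :
  (0 < n)%N -> (1 < p)%N -> (0 < M)%N -> 0 < sigma -> 0 < A -> 2 <= A ^+ 2 ->
  n%:R <= 16 * ln p%:R * M%:R :> R ->
  1024 * (2048 * (k%:R * ln p%:R)) <= n%:R :> R -> (l0norm beta <= k)%N ->
  lasso_objective (lasso_lambda A sigma n p) z b <=
    lasso_objective (lasso_lambda A sigma n p) z beta ->
  sqnorm (residual z beta) <= 4 * n%:R * sigma ^+ 2 ->
  (forall j, n%:R / 16 <= sqnorm (col j z.1) <= 4 * n%:R) ->
  (forall v, n%:R / 16 * sqnorm v <=
    sqnorm (z.1 *m v) + 4 * n%:R / M%:R * (\sum_j `|v j 0|) ^+ 2) ->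
  sqnorm (b - beta) <= 32 * (128 * 129 + A ^+ 2) * sigma ^+ 2.
Proof.
move=> n0 p1 M0 s0 A0 A2 NM kl bk obj eps4 cols RE.
have N0 : 0 < n%:R :> R by rewrite ltr0n.
have l0 : 0 < ln p%:R :> R by rewrite ln_gt0// ltr1n.
set lam := lasso_lambda A sigma n p in obj *.
have lam0 : 0 < lam by rewrite !mulr_gt0// sqrtr_gt0 divr_gt0.
have lam2 : lam ^+ 2 = A ^+ 2 * (ln p%:R / n%:R) * sigma ^+ 2.
  by rewrite !exprMn sqr_sqrtr// divr_ge0// ltW.
set h := b - beta.
pose S := [set i | beta i 0 != 0]%SET.
pose w j := l2norm (col j z.1) / Num.sqrt n%:R.
have w_bnd j : 1 / 4 <= w j <= 2.
  have /andP[c1 c2] := cols j.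
  rewrite /w /l2norm ler_pdivlMr ?sqrtr_gt0// ler_pdivrMr ?sqrtr_gt0//.
  apply/andP; split.
  - rewrite -(@ler_pXn2r _ 2) ?nnegrE ?mulr_ge0 ?sqrtr_ge0//.
    by rewrite exprMn !sqr_sqrtr ?sqnorm_ge0 ?(ltW N0)//; lra.
  - rewrite -(@ler_pXn2r _ 2) ?nnegrE ?mulr_ge0 ?sqrtr_ge0//.
    by rewrite exprMn !sqr_sqrtr ?sqnorm_ge0 ?(ltW N0)//; lra.
pose a1 := \sum_(j in S) `|h j 0|.
pose Ws := \sum_(j in S) w j * `|h j 0|.
pose W := \sum_j w j * `|h j 0|.
have res : residual z b = residual z beta - z.1 *m h.
  by rewrite /residual /h mulmxBr opprB addrA addrNK.
apply: (@lasso_scalar A sigma (ln p%:R) n%:R k%:R M%:R lam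
  (sqnorm (residual z b) / n%:R) (sqnorm (residual z beta) / n%:R) a1
  (\sum_j `|h j 0|) (sqnorm (z.1 *m h) / n%:R) _ W Ws) => //.
- by rewrite ltr0n.
(* Coordinatewise: on the support |b_j| - |beta_j| >= - |h_j|; off it beta_j = 0 and the difference
   is |h_j|. *)
- have : lam * W - 2 * lam * Ws <= lam * (\sum_j w j * `|b j 0|) - lam * (\sum_j w j * `|beta j 0|).
    have -> : lam * W - 2 * lam * Ws = lam * (W - 2 * Ws) by ring.
    rewrite -mulrBr ler_pM2l// -sumrB /W /Ws [X in _ - 2 * X]big_mkcond/= mulr_sumr -sumrB.
    apply: ler_sum => j _; have /andP[w1 _] := w_bnd j.
    have w0 : 0 <= w j by lra.
    rewrite -mulrBr; case: ifPn; rewrite inE => jS.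
      have -> : w j * `|h j 0| - 2 * (w j * `|h j 0|) = w j * (- `|h j 0|) by ring.
      rewrite ler_wpM2l// lerNl opprB (le_trans (lerB_dist _ _))// distrC.
      by rewrite /h !mxE.
    move/negPn/eqP: jS => b0.
    by rewrite mulr0 subr0 ler_wpM2l// /h !mxE b0 normr0 !subr0.
  move: obj; rewrite /lasso_objective.
  have wE (v : 'cV[R]_p) :
    \sum_j l2norm (col j z.1) / Num.sqrt n%:R * `|v j 0| = \sum_j w j * `|v j 0| by [].
  rewrite !wE; lra.
- rewrite /Ws /a1 mulr_sumr; apply: ler_sum => j _.
  by rewrite ler_wpM2r//; have /andP[] := w_bnd j.
- rewrite /W mulr_suml; apply: ler_sum => j _.
  by rewrite mulrC ler_wpM2r//; have /andP[] := w_bnd j; lra.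
- by rewrite divr_ge0// sqnorm_ge0.
- by rewrite divr_ge0// sqnorm_ge0.
- by rewrite ler_pdivrMr//; lra.
- exact: sumr_ge0.
- exact: sumr_ge0.
- exact: sqnorm_ge0.
- have ak : a1 ^+ 2 <= #|S|%:R * \sum_(j in S) `|h j 0| ^+ 2.
    exact: sqr_sum_le.
  apply: le_trans ak _; apply: ler_pM => //.
  + by apply: sumr_ge0 => j _; rewrite sqr_ge0.
  + by rewrite ler_nat.
  + rewrite /sqnorm big_mkcond/=; apply: ler_sum => j _.
    by case: ifPn => _; rewrite ?sqr_ge0// real_normK ?num_real.
- rewrite 2!mulrA -mulrDl ler_pM2r ?invr_gt0//.
  rewrite /sqnorm !mulr_sumr -big_split/=; apply: ler_sum => i _.
  have -> : residual z b i 0 = residual z beta i 0 - (z.1 *m h) i 0.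
    by rewrite res mxE [X in _ + X]mxE.
  move: (residual z beta i 0) ((z.1 *m h) i 0) => y x.
  have -> : 2 * y ^+ 2 + 2 * (y - x) ^+ 2 = x ^+ 2 + (2 * y - x) ^+ 2 by ring.
  by rewrite lerDl sqr_ge0.
- have := RE h; rewrite -(ler_pM2l (_ : 0 < (n%:R : R)^-1)) ?invr_gt0// => H.
  have -> : sqnorm h / 16 = n%:R^-1 * (n%:R / 16 * sqnorm h) by field; rewrite gt_eqF.
  apply: le_trans H _; rewrite le_eqVlt; apply/orP; left; apply/eqP; field.
  by rewrite !gt_eqF// ltr0n.
Qed.

End lasso.

(** * Probability of the good event and conditional law of the residuals *)

Section sample_space.
Context (R : realType) (n p : nat).

(** The generating family is that of [sigma_of (@entry R n p)], so the measurability clause of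
    [lasso_estimator] is ordinary measurability on this type. *)
Definition sampleType := g_sigma_algebraType
  (\bigcup_c preimage_set_system setT (@entry R n p c) measurable).

Lemma measurable_entry c : measurable_fun (setT : set sampleType) (@entry R n p c).
Proof.
move=> _ B mB; rewrite setTI; exact: sigma_of_preimage.
Qed.

Lemma measurable_to_sample d (T : measurableType d) (g : T -> sampleType) :
  (forall c, measurable_fun setT (fun t => entry c (g t))) -> measurable_fun setT g.
Proof.
move=> mg _ B mB; rewrite setTI; move: B mB.
pose G : set_system sampleType := [set B | measurable (g @^-1` B)].
suff : sigma_of (@entry R n p) `<=` G by [].
apply: smallest_sub.
  split.
  - by rewrite /G/= preimage_set0.
  - by move=> A mA; rewrite /G/= setTD preimage_setC; exact: measurableC.
  - by move=> A mA; rewrite /G/= preimage_bigcup; apply: bigcup_measurable => i _; exact: mA.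
move=> _ [c _ [B mB <-]]; rewrite /G/= setTI.
by have := mg c measurableT B mB; rewrite setTI.
Qed.

End sample_space.

Section measurability.
Context d (T : measurableType d) (R : realType) (n p : nat).

Lemma measurable_sqnorm m (v : T -> 'cV[R]_m) :
  (forall i, measurable_fun setT (fun t => v t i 0)) ->
  measurable_fun setT (fun t => sqnorm (v t)).
Proof.
by move=> mv; apply: measurable_sum => i; exact: measurable_funX.
Qed.

Lemma measurable_design (g : T -> sampleType R n p) i j :
  measurable_fun setT g -> measurable_fun setT (fun t => (g t).1 i j).
Proof.
move=> mg; exact: (measurableT_comp (@measurable_entry R n p (inl (i, j))) mg).
Qed.

Lemma measurable_response (g : T -> sampleType R n p) i :
  measurable_fun setT g -> measurable_fun setT (fun t => (g t).2 i 0).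
Proof.
move=> mg; exact: (measurableT_comp (@measurable_entry R n p (inr i)) mg).
Qed.

Lemma measurable_design_mul (g : T -> sampleType R n p) (b : T -> 'cV[R]_p) i :
  measurable_fun setT g -> (forall j, measurable_fun setT (fun t => b t j 0)) ->
  measurable_fun setT (fun t => ((g t).1 *m b t) i 0).
Proof.
move=> mg mb; under eq_fun do rewrite mxE.
by apply: measurable_sum => j; apply: measurable_funM => //; exact: measurable_design.
Qed.

Lemma measurable_residual (g : T -> sampleType R n p) (b : T -> 'cV[R]_p) i :
  measurable_fun setT g -> (forall j, measurable_fun setT (fun t => b t j 0)) ->
  measurable_fun setT (fun t => residual (g t) (b t) i 0).
Proof.
move=> mg mb.
have -> : (fun t => residual (g t) (b t) i 0) =
    (fun t => (g t).2 i 0 - ((g t).1 *m b t) i 0).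
  by apply/funext => t; rewrite mxE [X in _ + X]mxE.
by apply: measurable_funB; [exact: measurable_response|exact: measurable_design_mul].
Qed.

End measurability.

Section subsamples.
Context (R : realType) (n1 n2 p : nat) (s : 'S_(n1 + n2)).

Lemma subsample1_design (z : sample R (n1 + n2) p) i j :
  (subsample1 s z).1 i j = z.1 (s (lshift n2 i)) j.
Proof. by rewrite !mxE. Qed.

Lemma subsample1_response (z : sample R (n1 + n2) p) i :
  (subsample1 s z).2 i 0 = z.2 (s (lshift n2 i)) 0.
Proof. by rewrite !mxE. Qed.

Lemma subsample2_design (z : sample R (n1 + n2) p) i j :
  (subsample2 s z).1 i j = z.1 (s (rshift n1 i)) j.
Proof. by rewrite !mxE. Qed.

Lemma subsample2_response (z : sample R (n1 + n2) p) i :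
  (subsample2 s z).2 i 0 = z.2 (s (rshift n1 i)) 0.
Proof. by rewrite !mxE. Qed.

Lemma measurable_subsample1 : measurable_fun (setT : set (sampleType R (n1 + n2) p))
  (@subsample1 R n1 n2 p s : _ -> sampleType R n1 p).
Proof.
apply: measurable_to_sample => -[[i j]|i].
  rewrite (_ : (fun t => _) =
      (fun t : sample R (n1 + n2) p => t.1 (s (lshift n2 i)) j)); last first.
    by apply/funext => t; exact: subsample1_design.
  exact: (@measurable_design _ _ _ _ _ id).
rewrite (_ : (fun t => _) = (fun t : sample R (n1 + n2) p => t.2 (s (lshift n2 i)) 0)); last first.
  by apply/funext => t; exact: subsample1_response.
exact: (@measurable_response _ _ _ _ _ id).
Qed.

Lemma measurable_subsample2 : measurable_fun (setT : set (sampleType R (n1 + n2) p))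
  (@subsample2 R n1 n2 p s : _ -> sampleType R n2 p).
Proof.
apply: measurable_to_sample => -[[i j]|i].
  rewrite (_ : (fun t => _) =
      (fun t : sample R (n1 + n2) p => t.1 (s (rshift n1 i)) j)); last first.
    by apply/funext => t; exact: subsample2_design.
  exact: (@measurable_design _ _ _ _ _ id).
rewrite (_ : (fun t => _) = (fun t : sample R (n1 + n2) p => t.2 (s (rshift n1 i)) 0)); last first.
  by apply/funext => t; exact: subsample2_response.
exact: (@measurable_response _ _ _ _ _ id).
Qed.

End subsamples.

Section rows.
Context d (T : measurableType d) (R : realType) (P : probability T R) (N p : nat).
Variable Y : 'I_N * 'I_p + 'I_N -> T -> R.
Hypothesis iidY : iid_gauss P Y.

Definition row_of (c : 'I_N * 'I_p + 'I_N) : 'I_N :=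
  match c with inl ij => ij.1 | inr i => i end.

Lemma sum_row_of (F : 'I_N * 'I_p + 'I_N -> R) (i : 'I_N) :
  \sum_(c | row_of c == i) F c = \sum_j F (inl (i, j)) + F (inr i).
Proof.
rewrite big_sumType/=; congr (_ + _); last by rewrite big_pred1_eq.
rewrite (reindex (fun j => (i, j)))/=.
  by apply: eq_bigl => j; rewrite eqxx.
exists snd => [//|[i' j]]; by rewrite inE/= => /eqP ->.
Qed.

(** Taking (u, w) = (beta - b, sigma) gives the residuals at a fixed b, and w = 0 gives the design
    applied to u. The map f selects the rows of a subsample. *)
Lemma rows_chi2 (m : nat) (f : 'I_m -> 'I_N) (u : 'cV[R]_p) (w : R) (B : set R) :
  injective f -> 0 < sqnorm u + w ^+ 2 -> measurable B ->
  P [set t | B ((\sum_i (\sum_j u j 0 * Y (inl (f i, j)) t +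
                   w * Y (inr (f i)) t) ^+ 2) / (sqnorm u + w ^+ 2))] =
  chi2_prob m B.
Proof.
move=> finj v0 mB; set v := sqnorm u + w ^+ 2 in v0 *.
pose a (c : 'I_N * 'I_p + 'I_N) := (match c with inl ij => u ij.2 0 | inr _ => w end) / Num.sqrt v.
pose r := [seq f i | i <- enum 'I_m].
have ur : uniq r by rewrite map_inj_uniq ?enum_uniq.
have := @chi2_rows _ _ _ _ _ Y iidY _ row_of a r B ur.
rewrite size_map size_enum_ord => <- //; last first.
  move=> i _; rewrite sum_row_of /a/=.
  under eq_bigr do rewrite expr_div_n.
  rewrite expr_div_n -mulr_suml -mulrDl sqr_sqrtr ?(ltW v0)//.
  by rewrite -[X in X / _]/v divff// gt_eqF.
have v1 : (Num.sqrt v) ^+ 2 = v by rewrite sqr_sqrtr// ltW.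
have sv0 : Num.sqrt v != 0 by rewrite gt_eqF// sqrtr_gt0.
have E t : (\sum_i (\sum_j u j 0 * Y (inl (f i, j)) t + w * Y (inr (f i)) t) ^+ 2) / v =
    \sum_(i <- r) (\sum_(c | row_of c == i) a c * Y c t) ^+ 2.
  rewrite big_map big_enum/= mulr_suml; apply: eq_bigr => i _.
  rewrite sum_row_of /a/= -[in LHS]v1 -expr_div_n mulrDl mulr_suml; congr ((_ + _) ^+ 2).
    by apply: eq_bigr => j _; rewrite mulrAC.
  by rewrite mulrAC.
by congr (P _); apply/seteqP; split => t /=; rewrite E.
Qed.

End rows.

Lemma measure_bigcup_finType_le d (T : measurableType d) (R : realType)
    (P : probability T R) (I : finType) (A : I -> set T) (e : R) :
  (forall i, measurable (A i)) -> (forall i, (P (A i) <= e%:E)%E) ->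
  (P (\bigcup_i A i) <= (#|I|%:R * e)%:E)%E.
Proof.
move=> mA Ae.
have -> : \bigcup_i A i = \big[setU/set0]_(i <- enum I) A i.
  rewrite -bigcup_seq; apply/seteqP; split => t [i _ Ai]; exists i => //.
  by rewrite /= mem_enum.
rewrite cardE; elim: (enum I) => [|i r IH].
  by rewrite big_nil measure0 mul0r.
rewrite big_cons.
apply: (@le_trans _ _ (P (A i) + P (\big[setU/set0]_(j <- r) A j))%E).
  by apply: measureU2 => //; exact: bigsetU_measurable.
have -> : (size (i :: r))%:R * e = e + (size r)%:R * e.
  by rewrite -[(size (i :: r))%:R]natr1 mulrDl mul1r addrC.
rewrite EFinD.
exact: leeD (Ae i) IH.
Qed.

(** * The good event and its probability *)

Section good_event.
Context (R : realType) (n p M : nat) (beta : 'cV[R]_p) (sigma : R).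

(** Finitely many inequalities, each failing with probability at most exp(- n / 2). A lower bound on
    the column norms is contained in the third family, through constant tuples. Strict inequalities
    make the first failures closed upper tails, as in [chi2_prob_upper]. *)
Definition good_sample : set (sampleType R n p) :=
  [set z | [/\ forall j, sqnorm (col j z.1) < 4 * n%:R,
      sqnorm (residual z beta) < 4 * n%:R * sigma ^+ 2 &
      forall s : M.-tuple ('I_p * bool),
        n%:R / 16 * sqnorm (unit_sum R s) <= sqnorm (z.1 *m unit_sum R s)]].

Let bad (i : 'I_p + unit + M.-tuple ('I_p * bool)) : set (sampleType R n p) :=
  match i with
  | inl (inl j) => [set z | 4 * n%:R <= sqnorm (col j z.1)]
  | inl (inr _) => [set z | 4 * n%:R * sigma ^+ 2 <= sqnorm (residual z beta)]
  | inr s => [set z | sqnorm (z.1 *m unit_sum R s) < n%:R / 16 * sqnorm (unit_sum R s)]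
  end.

Let setC_good : ~` good_sample = \bigcup_i bad i.
Proof.
apply/seteqP; split => z.
  apply: contra_notP => h; split.
  - move=> j; rewrite ltNge; apply/negP => H; apply: h; by exists (inl (inl j)).
  - rewrite ltNge; apply/negP => H; apply: h; by exists (inl (inr tt)).
  - move=> s; rewrite leNgt; apply/negP => H; apply: h; by exists (inr s).
move=> [[[j|[]]|s] _ /= zb] [h1 h2 h3].
- by have := le_lt_trans zb (h1 j); rewrite ltxx.
- by have := le_lt_trans zb h2; rewrite ltxx.
- by have := lt_le_trans zb (h3 s); rewrite ltxx.
Qed.

Let measurable_col j : measurable_fun (setT : set (sampleType R n p))
  (fun z : sample R n p => sqnorm (col j z.1)).
Proof.
apply: measurable_sqnorm => i.
rewrite (_ : (fun z => _) = (fun z : sample R n p => z.1 i j)); last by apply/funext => z; rewrite mxE.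
exact: (@measurable_design _ _ _ _ _ id).
Qed.

Let measurable_bad i : measurable (bad i).
Proof.
case: i => [[j|[]]|s] /=; rewrite -[X in measurable X]setTI.
- have := measurable_col j measurableT (measurable_itv `[4 * n%:R, +oo[).
  by congr measurable; apply/seteqP; split => z /= []; rewrite in_itv/= andbT.
- have h : measurable_fun (setT : set (sampleType R n p))
      (fun z : sample R n p => sqnorm (residual z beta)).
    apply: measurable_sqnorm => i.
    by apply: (@measurable_residual _ _ _ _ _ id (fun=> beta)) => // j; exact: measurable_cst.
  have := h measurableT _ (measurable_itv `[4 * n%:R * sigma ^+ 2, +oo[).
  by congr measurable; apply/seteqP; split => z /= []; rewrite in_itv/= andbT.
- have h : measurable_fun (setT : set (sampleType R n p))
      (fun z : sample R n p => sqnorm (z.1 *m unit_sum R s)).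
    apply: measurable_sqnorm => i.
    by apply: (@measurable_design_mul _ _ _ _ _ id (fun=> unit_sum R s)) => // j; exact: measurable_cst.
  have := h measurableT _ (measurable_itv `]-oo, n%:R / 16 * sqnorm (unit_sum R s)[).
  by congr measurable; apply/seteqP; split => z /= []; rewrite in_itv/=.
Qed.

Lemma measurable_good_sample : measurable good_sample.
Proof.
rewrite -[good_sample]setCK setC_good; apply: measurableC.
apply: fin_bigcup_measurable => // i _; exact: measurable_bad.
Qed.

Context d (T : measurableType d) (P : probability T R) (N : nat).
Variables (Z : T -> sample R N p) (f : 'I_n -> 'I_N) (z1 : T -> sampleType R n p).
Hypotheses (s0 : 0 < sigma) (finj : injective f).
Hypothesis z1X : forall t i j, (z1 t).1 i j = (Z t).1 (f i) j.
Hypothesis z1y : forall t i, (z1 t).2 i 0 = (Z t).2 (f i) 0.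
Hypothesis mz1 : measurable_fun setT z1.
Hypothesis iidY : iid_gauss P (fun c t => zvar beta sigma (Z t) c).

Lemma sub_residual (b : 'cV[R]_p) t i :
  residual (z1 t) b i 0 = residual (Z t) b (f i) 0.
Proof.
rewrite mxE [RHS]mxE [X in _ + X]mxE [X in _ = _ + X]mxE !mxE z1y; congr (_ - _).
by apply: eq_bigr => j _; rewrite z1X.
Qed.

Lemma sample_residual_law (b : 'cV[R]_p) (B : set R) : measurable B ->
  P [set t | B (sqnorm (residual (z1 t) b) / (sqnorm (b - beta) + sigma ^+ 2))] =
  chi2_prob n B.
Proof.
move=> mB.
have sE : sqnorm (beta - b) = sqnorm (b - beta).
  by apply: eq_bigr => j _; rewrite !mxE -sqrrN opprB.
have v0 : 0 < sqnorm (beta - b) + sigma ^+ 2.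
  by rewrite ltr_wpDl ?sqnorm_ge0// exprn_gt0.
rewrite -(rows_chi2 iidY finj v0 mB) -sE; congr (P _).
suff E t : sqnorm (residual (z1 t) b) =
   \sum_i (\sum_j (beta - b) j 0 * zvar beta sigma (Z t) (inl (f i, j)) +
           sigma * zvar beta sigma (Z t) (inr (f i))) ^+ 2.
  by apply/seteqP; split => t /=; rewrite E.
apply: eq_bigr => i _; congr (_ ^+ 2); rewrite sub_residual /= mulVKf ?gt_eqF//.
rewrite mxE [X in _ + X]mxE mxE [in RHS]mxE [X in _ = _ + (_ + X)]mxE [X in _ = _ + (_ - X)]mxE.
rewrite addrCA; congr (_ + _); rewrite -sumrN -sumrN -big_split/=.
apply: eq_bigr => j _; rewrite !mxE; ring.
Qed.

Lemma sample_design_law (u : 'cV[R]_p) (B : set R) : 0 < sqnorm u -> measurable B ->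
  P [set t | B (sqnorm ((z1 t).1 *m u) / sqnorm u)] = chi2_prob n B.
Proof.
move=> u0 mB.
have v0 : 0 < sqnorm u + 0 ^+ 2 by rewrite expr0n addr0.
rewrite -(rows_chi2 iidY finj v0 mB) expr0n/= addr0; congr (P _).
suff E t : sqnorm ((z1 t).1 *m u) =
   \sum_i (\sum_j u j 0 * zvar beta sigma (Z t) (inl (f i, j)) +
           0 * zvar beta sigma (Z t) (inr (f i))) ^+ 2.
  by apply/seteqP; split => t /=; rewrite E.
apply: eq_bigr => i _; congr (_ ^+ 2); rewrite mul0r addr0 mxE.
by apply: eq_bigr => j _; rewrite /= z1X mulrC.
Qed.

Let sqnorm_delta j : sqnorm (delta_mx j 0 : 'cV[R]_p) = 1.
Proof.
rewrite /sqnorm (bigD1 j)//= big1 => [|i ij]; last by rewrite mxE (negbTE ij) expr0n.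
by rewrite mxE !eqxx expr1n addr0.
Qed.

Let bad_le i : (P (z1 @^-1` bad i) <= (expR (- (n%:R / 2)))%:E)%E.
Proof.
case: i => [[j|[]]|s] /=.
- apply: le_trans (chi2_prob_upper R n).
  rewrite -(@sample_design_law (delta_mx j 0)) ?sqnorm_delta//.
  rewrite le_eqVlt; apply/orP; left; apply/eqP; congr (P _).
  by apply/seteqP; split => t /=; rewrite in_itv/= andbT divr1 -colE.
- apply: le_trans (chi2_prob_upper R n).
  rewrite -(@sample_residual_law beta)//.
  have -> : sqnorm (beta - beta) = 0.
    by rewrite /sqnorm big1// => j _; rewrite !mxE subrr expr0n.
  rewrite le_eqVlt; apply/orP; left; apply/eqP; congr (P _).
  by apply/seteqP; split => t /=; rewrite in_itv/= andbT add0r ler_pdivlMr// exprn_gt0.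
- have [u0|u0] := ltP 0 (sqnorm (unit_sum R s)).
    apply: le_trans (chi2_prob_lower R n).
    rewrite -(@sample_design_law _ _ u0)//; apply: le_measure; rewrite ?inE.
    + rewrite -[X in measurable X]setTI; apply: mz1 => //.
      exact: (measurable_bad (inr s)).
    + rewrite -[X in measurable X]setTI.
      suff : measurable_fun setT (fun t => sqnorm ((z1 t).1 *m unit_sum R s) / sqnorm (unit_sum R s)).
        by move=> h; exact: (h measurableT _ (measurable_itv _)).
      apply: measurable_funM => //; apply: measurable_sqnorm => i.
      by apply: (@measurable_design_mul _ _ _ _ _ z1 (fun=> unit_sum R s)) => // j; exact: measurable_cst.
    + by move=> t /=; rewrite in_itv/= => /ltW; rewrite ler_pdivrMr.
  (* Opposite signs may cancel in a sum of units; the event is then empty. *)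
  have {}u0 : sqnorm (unit_sum R s) = 0 by apply/eqP; rewrite eq_le u0 sqnorm_ge0.
  rewrite (_ : _ @^-1` _ = set0) ?measure0 ?lee_fin ?expR_ge0//.
  apply/seteqP; split => t //=; rewrite u0 mulr0 => h.
  by rewrite ltNge sqnorm_ge0 in h.
Qed.

Lemma prob_not_good_sample : (P (z1 @^-1` (~` good_sample)) <=
  ((p + 1 + (p * 2) ^ M)%:R * expR (- (n%:R / 2)))%:E)%E.
Proof.
rewrite setC_good preimage_bigcup.
apply: le_trans (measure_bigcup_finType_le _ bad_le) _.
  by move=> i; rewrite -[X in measurable X]setTI; apply: mz1 => //; exact: measurable_bad.
by rewrite !card_sum card_ord card_unit card_tuple card_prod card_ord card_bool.
Qed.

End good_event.

Lemma measurable_fun_invr d (T : measurableType d) (R : realType) (f : T -> R) :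
  measurable_fun setT f -> (forall t, 0 <= f t) ->
  measurable_fun setT (fun t => (f t)^-1).
Proof.
move=> mf f0; rewrite (_ : (fun t => _) = (fun t => f t `^ (-1))).
  exact: (measurableT_comp (measurable_powR (-1)) mf).
by apply/funext => t; rewrite powR_inv1.
Qed.

(** * Independence of the subsamples for a fixed permutation *)

Section fixed_split.
Context d (T : measurableType d) (R : realType) (P : probability T R) (n1 n2 p : nat).
Variables (sg : 'S_(n1 + n2)) (beta : 'cV[R]_p) (sigma : R).
Variables (Z : T -> sampleType R (n1 + n2) p).
Variable bhat : sampleType R n1 p -> 'cV[R]_p.
Hypotheses (s0 : 0 < sigma) (mZ : measurable_fun setT Z).
Hypothesis mbhat : forall j, measurable_fun setT (fun z => bhat z j 0).
Let Y c t := zvar beta sigma (Z t) c.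
Hypothesis iidY : iid_gauss P Y.

Let U t : sampleType R n1 p := subsample1 sg (Z t).
Let V t : sampleType R n2 p := subsample2 sg (Z t).

Let f1 i := sg (lshift n2 i).
Let f2 i := sg (rshift n1 i).

Let f2_inj : injective f2. Proof. by move=> i j /perm_inj /rshift_inj. Qed.

Let mU : measurable_fun setT U.
Proof. exact: measurableT_comp (measurable_subsample1 sg) mZ. Qed.

Let mV : measurable_fun setT V.
Proof. exact: measurableT_comp (measurable_subsample2 sg) mZ. Qed.

Let VX t i j : (V t).1 i j = (Z t).1 (f2 i) j.
Proof. exact: subsample2_design. Qed.
Let Vy t i : (V t).2 i 0 = (Z t).2 (f2 i) 0.
Proof. exact: subsample2_response. Qed.
Let UX t i j : (U t).1 i j = (Z t).1 (f1 i) j.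
Proof. exact: subsample1_design. Qed.
Let Uy t i : (U t).2 i 0 = (Z t).2 (f1 i) 0.
Proof. exact: subsample1_response. Qed.

Let rowset m (f : 'I_m -> 'I_(n1 + n2)) : {set 'I_(n1 + n2) * 'I_p + 'I_(n1 + n2)} :=
  [set c | row_of c \in codom f]%SET.

Let measurable_rows m (f : 'I_m -> 'I_(n1 + n2)) (W : T -> sampleType R m p) :
  (forall t i j, (W t).1 i j = (Z t).1 (f i) j) ->
  (forall t i, (W t).2 i 0 = (Z t).2 (f i) 0) ->
  measurable_fun (setT : set (sigma_onType Y (rowset f))) W.
Proof.
move=> WX Wy; apply: measurable_to_sample.
have mX i j : measurable_fun (setT : set (sigma_onType Y (rowset f))) (fun t => (Z t).1 (f i) j).
  by apply: (@measurable_sigma_onType _ _ _ _ Y _ (inl (f i, j))); rewrite inE; exact: codom_f.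
case=> [[i j]|i].
  by rewrite (_ : (fun t => _) = (fun t => (Z t).1 (f i) j))//; apply/funext => t; exact: WX.
have mE : measurable_fun (setT : set (sigma_onType Y (rowset f)))
    (fun t => sigma^-1 * residual (Z t) beta (f i) 0).
  by apply: (@measurable_sigma_onType _ _ _ _ Y _ (inr (f i))); rewrite inE; exact: codom_f.
(* A response is recovered from the Gaussian coordinates of its own row, as the linear predictor
   plus sigma times the normalised noise. *)
rewrite (_ : (fun t => _) = (fun t => \sum_j (Z t).1 (f i) j * beta j 0 +
    sigma * (sigma^-1 * residual (Z t) beta (f i) 0))).
  apply: measurable_funD; last by apply: measurable_funM => //; exact: measurable_cst.
  by apply: measurable_sum => j; apply: measurable_funM => //; exact: measurable_cst.
apply/funext => t; rewrite mulVKf ?gt_eqF// [entry _ _]Wy.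
by rewrite mxE [X in _ + (_ + X)]mxE [X in _ - X]mxE addrC subrK.
Qed.

Lemma subsamples_indep A B : measurable A -> measurable B ->
  P (U @^-1` A `&` V @^-1` B) = (P (U @^-1` A) * P (V @^-1` B))%E.
Proof.
move=> mA mB.
have J12 c : c \in rowset f1 -> c \notin rowset f2.
  rewrite !inE => /codomP[i ->]; apply/negP => /codomP[j] /perm_inj /eqP.
  by rewrite eq_lrshift.
apply: (indep2_sigma_on iidY J12).
  by have := measurable_rows UX Uy measurableT mA; rewrite setTI.
by have := measurable_rows VX Vy measurableT mB; rewrite setTI.
Qed.

Let rss (z : sampleType R n1 p * sampleType R n2 p) : R := sqnorm (residual z.2 (bhat z.1)).
Let risk (z : sampleType R n1 p) : R := sqnorm (bhat z - beta).

Let mbhatB j : measurable_fun setT (fun z => (bhat z - beta) j 0).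
Proof.
rewrite (_ : (fun z => _) = (fun z => bhat z j 0 - beta j 0)).
  by apply: measurable_funB => //; exact: measurable_cst.
by apply/funext => z; rewrite !mxE.
Qed.

Lemma measurable_risk : measurable_fun setT risk.
Proof. exact: measurable_sqnorm. Qed.

Lemma measurable_rss : measurable_fun setT rss.
Proof.
apply: measurable_sqnorm => i.
apply: (@measurable_residual _ _ _ _ _ snd (fun z => bhat z.1)); first exact: measurable_snd.
by move=> j; exact: (measurableT_comp (mbhat j) measurable_fst).
Qed.

Let risk_gt0 b : 0 < sqnorm (b - beta) + sigma ^+ 2.
Proof. by rewrite ltr_wpDl ?sqnorm_ge0// exprn_gt0. Qed.

(* Given the first subsample, the residuals of the second one are i.i.d. centred
   Gaussian with variance |bhat - beta|^2 + sigma^2. *)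
Lemma normalized_rss_law (B : set R) : measurable B ->
  P [set t | B (rss (U t, V t) / (risk (U t) + sigma ^+ 2))] = chi2_prob n2 B.
Proof.
move=> mB.
pose g (z : sampleType R n1 p * sampleType R n2 p) : R := rss z / (risk z.1 + sigma ^+ 2).
have mg : measurable_fun setT g.
  apply: measurable_funM; first exact: measurable_rss.
  apply: measurable_fun_invr; last by move=> z; exact: ltW (risk_gt0 _).
  apply: measurable_funD; last exact: measurable_cst.
  exact: measurableT_comp measurable_risk measurable_fst.
have mS : measurable (g @^-1` B) by rewrite -[X in measurable X]setTI; exact: mg.
pose i1 (z : sampleType R n1 p * sampleType R n2 p) : \bar R := (\1_(g @^-1` B) z)%:E.
transitivity (\int[P]_t i1 (U t, V t))%E.
  have mUV : measurable ((fun t => (U t, V t)) @^-1` (g @^-1` B)).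
    rewrite -[X in measurable X]setTI.
    by have := measurable_fun_pair mU mV; apply.
  transitivity (\int[P]_t (\1_((fun t => (U t, V t)) @^-1` (g @^-1` B)) t)%:E)%E; last by [].
  by rewrite integral_indic// setIT.
have mi1 : measurable_fun setT i1 by exact/measurable_EFinP/measurable_indic.
have i10 z : (0 <= i1 z)%E by rewrite lee_fin.
rewrite (ge0_integral_indep mU mV subsamples_indep mi1 i10).
transitivity (\int[P]_t chi2_prob n2 B)%E.
  apply: eq_integral => t1 _.
  rewrite -(sample_residual_law s0 f2_inj VX Vy iidY (bhat (U t1)) mB).
  have mV1 : measurable ((fun t => (U t1, V t)) @^-1` (g @^-1` B)).
    rewrite -[X in measurable X]setTI.
    have := measurable_fun_pair (@measurable_cst _ _ T _ setT (U t1)) mV; exact.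
  transitivity (\int[P]_t (\1_((fun t => (U t1, V t)) @^-1` (g @^-1` B)) t)%:E)%E; first by [].
  by rewrite integral_indic// setIT.
have [mu [muE _ _]] := chi2_law R n2.
rewrite muE// -(fineK (fin_num_measure mu B mB)).
by rewrite integral_cst// [X in (_ * X)%E]probability_setT mule1.
Qed.

Let mean_rss (b : 'cV[R]_p) :
  (\int[P]_t (sqnorm (residual (V t) b))%:E <=
   ((sqnorm (b - beta) + sigma ^+ 2) * (6 * n2%:R))%:E)%E.
Proof.
have [mu [muE _ mu6]] := chi2_law R n2.
set v := sqnorm _ + _.
have v0 : 0 < v by exact: risk_gt0.
pose W t : measurableTypeR R := sqnorm (residual (V t) b) / v.
have mr : measurable_fun setT (fun t => sqnorm (residual (V t) b)).
  apply: measurable_sqnorm => i.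
  by apply: (@measurable_residual _ _ _ _ _ V (fun=> b)) => // j; exact: measurable_cst.
have mW : measurable_fun setT W.
  suff : measurable_fun setT (fun t => sqnorm (residual (V t) b) / v) by [].
  exact: measurable_funM.
have -> : (\int[P]_t (sqnorm (residual (V t) b))%:E = v%:E * \int[P]_t `|W t|%:E)%E.
  rewrite -ge0_integralZl//.
  - apply: eq_integral => t _; rewrite -EFinM ger0_norm ?divr_ge0 ?sqnorm_ge0 ?(ltW v0)//.
    by rewrite /W mulrC divfK// gt_eqF.
  - by apply/measurable_EFinP; apply: measurableT_comp.
  - by rewrite lee_fin ltW.
rewrite EFinM; apply: lee_wpmul2l; first by rewrite lee_fin ltW.
apply: le_trans mu6; rewrite le_eqVlt; apply/orP; left; apply/eqP.
have mabs : measurable_fun setT (fun x : measurableTypeR R => `|x : R|%:E) by exact/measurable_EFinP.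
rewrite -(@ge0_integral_distribution _ _ _ _ _ P (mfun_Sub (mem_set mW)) (fun x => `|x|%:E))//.
apply: eq_measure_integral => A mA _; transitivity (chi2_prob n2 A); last exact: muE.
by rewrite -(sample_residual_law s0 f2_inj VX Vy iidY b mA).
Qed.

(** [G] concerns the first subsample only. Once that is frozen, either the indicator is 0 or the
    estimator is a fixed vector of risk at most H, and [mean_rss] applies. *)
Lemma mean_rss_on (G : set (sampleType R n1 p)) (H : R) : measurable G ->
  (forall z, G z -> risk z <= H) -> 0 <= H ->
  (\int[P]_t (\1_G (U t) * rss (U t, V t))%:E <= ((H + sigma ^+ 2) * (6 * n2%:R))%:E)%E.
Proof.
move=> mG GH H0.
pose g (z : sampleType R n1 p * sampleType R n2 p) : \bar R := (\1_G z.1 * rss z)%:E.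
have mg : measurable_fun setT g.
  apply/measurable_EFinP; apply: measurable_funM; last exact: measurable_rss.
  by apply: measurableT_comp => //; exact: measurable_indic.
have g0 z : (0 <= g z)%E by rewrite lee_fin mulr_ge0 ?sqnorm_ge0.
rewrite (ge0_integral_indep mU mV subsamples_indep mg g0).
have HS : 0 <= (H + sigma ^+ 2) * (6 * n2%:R).
  by rewrite mulr_ge0// ?addr_ge0 ?sqr_ge0// mulr_ge0.
apply: (@le_trans _ _ (\int[P]_t ((H + sigma ^+ 2) * (6 * n2%:R))%:E)%E); last first.
  by rewrite integral_cst// [X in (_ * X)%E]probability_setT mule1.
apply: ge0_le_integral => //.
- by move=> t _; exact: integral_ge0.
- pose g' (z : T * T) : \bar R := g (U z.1, V z.2).
  have mg' : measurable_fun setT g'.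
    apply: (measurableT_comp mg); apply: measurable_fun_pair.
      exact: measurableT_comp mU measurable_fst.
    exact: measurableT_comp mV measurable_snd.
  exact: (@measurable_fun_fubini_tonelli_F _ _ _ _ _ P g' mg' (fun z => g0 _)).
- move=> t _; rewrite /g/= indicE.
  have [tG|tG] := boolP (U t \in G); last first.
    by under eq_integral do rewrite mul0r; rewrite integral0 lee_fin.
  under eq_integral do rewrite mul1r.
  apply: (@le_trans _ _ (((risk (U t) + sigma ^+ 2) * (6 * n2%:R))%:E)).
    exact: (mean_rss (bhat (U t))).
  rewrite lee_fin; apply: ler_wpM2r; first exact: mulr_ge0.
  by rewrite lerD2r; apply: GH; exact: set_mem.
Qed.

End fixed_split.

(** * The random split and the confidence interval *)

Section random_split.
Context d (T : measurableType d) (R : realType) (P : probability T R) (N p : nat).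
Variables (Z : T -> sampleType R N p) (s : T -> 'S_N).
Hypotheses (mZ : measurable_fun setT Z) (rs : random_split P Z s).

Let split_indep (sg : 'S_N) (f : sampleType R N p -> R) :
  measurable_fun setT f -> (forall z, 0 <= f z) ->
  (\int[P]_t (\1_(s @^-1` [set sg]) t * f (Z t))%:E =
   (N`!%:R^-1)%:E * \int[P]_t (f (Z t))%:E)%E.
Proof.
move=> mf f0; have [mS PS iS] := rs sg.
set S := s @^-1` [set sg].
(* The event that the split equals [sg] is viewed as a random element: the identity into T with the
   sigma-algebra generated by that event. *)
pose TS := g_sigma_algebraType [set S].
pose U (t : T) : TS := t.
have mU : measurable_fun setT U.
  move=> _ B mB; rewrite setTI.
  suff : <<s [set S] >> `<=` (measurable : set (set T)) by apply.
  by apply: smallest_sub; [exact: sigma_algebra_measurable|move=> _ ->].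
have mS' : measurable (S : set TS) by apply: sub_gen_smallest.
pose G := \bigcup_c preimage_set_system setT (fun t => entry c (Z t)) measurable.
have UZ A B : measurable A -> measurable B ->
    P (U @^-1` A `&` Z @^-1` B) = (P (U @^-1` A) * P (Z @^-1` B))%E.
  move=> mA mB.
  have sm : sigma_of (fun c t => entry c (Z t)) `<=` (measurable : set (set T)).
    apply: smallest_sub; first exact: sigma_algebra_measurable.
    move=> _ [c _ [C mC <-]].
    by have := measurableT_comp (@measurable_entry R N p c) mZ; apply.
  have := @indep2_sigma _ _ _ P _ _ _ sm _ _ iS; apply.
  - by move=> _ ->.
  - by move=> _ _ -> ->; rewrite setIid.
  - move=> C D GC GD.
    exact: (@measurableI _ (g_sigma_algebraType G) C D GC GD).
  - exact: mA.
  - apply: sub_gen_smallest.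
    have mZ' : measurable_fun (setT : set (g_sigma_algebraType G)) Z.
      apply: measurable_to_sample => c _ C mC; rewrite setTI.
      exact: (@sigma_of_preimage _ _ _ (fun c t => entry c (Z t))).
    by have := mZ' measurableT B mB; rewrite setTI.
pose g (z : TS * sampleType R N p) : \bar R := (\1_S z.1 * f z.2)%:E.
have mg : measurable_fun setT g.
  apply/measurable_EFinP; apply: measurable_funM; last exact: measurableT_comp mf measurable_snd.
  by apply: measurableT_comp (measurable_indic _) measurable_fst.
have g0 z : (0 <= g z)%E by rewrite lee_fin mulr_ge0.
have mfZ : measurable_fun setT (fun t => (f (Z t))%:E).
  by apply/measurable_EFinP; exact: measurableT_comp mf mZ.
have i0 : (0 <= \int[P]_t (f (Z t))%:E)%E by apply: integral_ge0 => t _; rewrite lee_fin.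
rewrite (@ge0_integral_indep _ _ _ P _ _ _ _ U Z g mU mZ UZ mg g0).
transitivity (\int[P]_t ((\1_S t)%:E * \int[P]_t2 (f (Z t2))%:E))%E.
  apply: eq_integral => t _; rewrite -ge0_integralZl//.
  by move=> t2 _; rewrite lee_fin.
rewrite ge0_integralZr//.
- by congr (_ * _)%E; rewrite (integral_indic P measurableT mS) setIT.
- exact/measurable_EFinP/measurable_indic.
Qed.

(** Total expectation over the split: any bound valid for each fixed permutation passes to the
    random one. *)
Lemma split_average (f : 'S_N -> sampleType R N p -> R) :
  (forall sg, measurable_fun setT (f sg)) -> (forall sg z, 0 <= f sg z) ->
  (\int[P]_t (f (s t) (Z t))%:E =
   \sum_(sg : 'S_N) ((N`!%:R^-1)%:E * \int[P]_t (f sg (Z t))%:E))%E.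
Proof.
move=> mf f0.
transitivity (\int[P]_t (\sum_(sg : 'S_N) (\1_(s @^-1` [set sg]) t * f sg (Z t))%:E))%E.
  apply: eq_integral => t _; rewrite (bigD1 (s t))//= big1 ?adde0.
    by rewrite indicE mem_set// mul1r.
  move=> sg /eqP sgs; rewrite indicE memNset ?mul0r//= => h; exact: sgs.
rewrite ge0_integral_sum//.
- by apply: eq_bigr => sg _; exact: split_indep.
- move=> sg; apply/measurable_EFinP; apply: measurable_funM; last exact: measurableT_comp (mf sg) mZ.
  by apply: measurable_indic; have [] := rs sg.
- by move=> sg t _; rewrite lee_fin mulr_ge0.
Qed.

Let sum_cst (x : R) : (\sum_(sg : 'S_N) ((N`!%:R^-1)%:E * x%:E) = x%:E)%E.
Proof.
under eq_bigr do rewrite -EFinM.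
rewrite sumEFin sumr_const [#|_|]card_Sn -[(_ * x) *+ _]mulr_natr.
by rewrite mulrAC mulVf ?mul1r// pnatr_eq0 -lt0n fact_gt0.
Qed.

Lemma split_average_le (f : 'S_N -> sampleType R N p -> R) (x : R) :
  (forall sg, measurable_fun setT (f sg)) -> (forall sg z, 0 <= f sg z) ->
  (forall sg, \int[P]_t (f sg (Z t))%:E <= x%:E)%E ->
  (\int[P]_t (f (s t) (Z t))%:E <= x%:E)%E.
Proof.
move=> mf f0 fx; rewrite split_average// -[leRHS]sum_cst.
by apply: lee_sum => sg _; rewrite lee_wpmul2l// lee_fin invr_ge0.
Qed.

Lemma split_average_ge (f : 'S_N -> sampleType R N p -> R) (x : R) :
  (forall sg, measurable_fun setT (f sg)) -> (forall sg z, 0 <= f sg z) ->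
  (forall sg, x%:E <= \int[P]_t (f sg (Z t))%:E)%E ->
  (x%:E <= \int[P]_t (f (s t) (Z t))%:E)%E.
Proof.
move=> mf f0 fx; rewrite split_average// -[leLHS]sum_cst.
by apply: lee_sum => sg _; rewrite lee_wpmul2l// lee_fin invr_ge0.
Qed.

End random_split.

(** * Coverage and expected length at fixed dimensions *)

Section fixed_dimension.
Context d (T : measurableType d) (R : realType) (n1 n2 p k : nat).
Variables (A sigma : R) (th : param R p) (P : probability T R).
Variables (Z : T -> sampleType R (n1 + n2) p).
Variable bhat : sampleType R n1 p -> 'cV[R]_p.
Hypotheses (n10 : (0 < n1)%N) (n20 : (0 < n2)%N) (p1 : (1 < p)%N) (k0 : (0 < k)%N).
Hypotheses (s0 : 0 < sigma) (A0 : 0 < A) (A2 : 2 <= A ^+ 2).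
Hypothesis kl : 1024 * (2048 * (k%:R * ln p%:R)) <= n1%:R :> R.
Hypothesis thP : Theta0 sigma k th.
Hypothesis lmP : linear_model P th Z.
Hypothesis bhatP : lasso_estimator A sigma bhat.

Let beta := coef th.
Let lp : R := ln p%:R.
Let lp0 : 0 < lp. Proof. by rewrite ln_gt0// ltr1n. Qed.
Let n1R : 0 < n1%:R :> R. Proof. by rewrite ltr0n. Qed.
Let n2R : 0 < n2%:R :> R. Proof. by rewrite ltr0n. Qed.

Definition risk_const : R := 32 * (128 * 129 + A ^+ 2).
(** The first term is the mean of the normalised residuals on the good event, with the 6 of
    [second_moment_gauss]; the final 1 is the cap of psi, in units of sigma^2, times the probability
    1 / ln p. *)
Definition mean_const : R := (risk_const + 1) * 6 + 1.

Let risk_const_ge0 : 0 <= risk_const.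
Proof.
exact: mulr_ge0 (ler0n _ _) (addr_ge0 (mulr_ge0 (ler0n _ _) (ler0n _ _)) (sqr_ge0 _)).
Qed.

Let iidY : iid_gauss P (fun c t => zvar beta sigma (Z t) c).
Proof. exact: linear_model_iid s0 thP lmP. Qed.

Let mZ : measurable_fun setT Z.
Proof. by apply: measurable_to_sample => c; have [h _ _ _ _] := lmP; exact: h. Qed.

Let mbhat j : measurable_fun setT (fun z => bhat z j 0).
Proof. by move=> _ B mB; rewrite setTI; case: bhatP => _; exact. Qed.

Let lp_n1 : 8 * lp <= n1%:R.
Proof.
have k1 : 1 <= k%:R :> R by rewrite ler1n.
have : lp <= k%:R * lp by rewrite ler_peMl// ltW.
have : 0 <= k%:R * lp by rewrite mulr_ge0// ltW.
move: kl; rewrite -/lp; move: (k%:R * lp) => x; lra.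
Qed.

(** M is the integer part of n1 / (8 ln p). This quotient is at least 1 because k >= 1 in [kl], so
    truncation loses at most a factor 2. *)
Let sparsity_exists : exists M : nat,
  [/\ (0 < M)%N, n1%:R <= 16 * lp * M%:R & 8 * lp * M%:R <= n1%:R].
Proof.
pose x := n1%:R / (8 * lp).
have l80 : 0 < 8 * lp by rewrite mulr_gt0.
have x1 : 1 <= x by rewrite ler_pdivlMr ?mul1r.
have x0 : 0 <= x by rewrite (le_trans _ x1).
have /andP[] := Num.Theory.truncn_itv x0; set M := Num.truncn x => Mx xM.
have M0 : (0 < M)%N by rewrite truncn_gt_nat.
have M1 : 1 <= M%:R :> R by rewrite ler1n.
exists M; split => //.
- move: xM; rewrite ltr_pdivrMr// -natr1 => /ltW h; apply: le_trans h _.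
  have -> : 16 * lp * M%:R = (M%:R + M%:R) * (8 * lp) by ring.
  by rewrite ler_pM2r// lerD2l.
- by move: Mx; rewrite ler_pdivlMr// mulrC.
Qed.

Let good_risk M z : (0 < M)%N -> n1%:R <= 16 * lp * M%:R ->
  good_sample M beta sigma z -> sqnorm (bhat z - beta) <= risk_const * sigma ^+ 2.
Proof.
move=> M0 NM [h1 h2 h3].
have cols j : n1%:R / 16 <= sqnorm (col j z.1) <= 4 * n1%:R.
  rewrite (ltW (h1 j)) andbT.
  (* The sum of M equal units is M e_j; dividing by M^2 gives the lower bound on the norm of column
     j. *)
  have := h3 [tuple of nseq M (j, false)].
  have -> : unit_sum R [tuple of nseq M (j, false)] = M%:R *: delta_mx j 0.
    rewrite /unit_sum big_nseq iter_addr_0 /signed_unit/= expr0 scale1r.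
    by rewrite scaler_nat.
  have SZ m (a : R) (v : 'cV[R]_m) : sqnorm (a *: v) = a ^+ 2 * sqnorm v.
    by rewrite /sqnorm mulr_sumr; apply: eq_bigr => i _; rewrite mxE exprMn.
  rewrite -scalemxAr !SZ -colE.
  have -> : sqnorm (delta_mx j 0 : 'cV[R]_p) = 1.
    rewrite /sqnorm (bigD1 j)//= big1 => [|i ij]; last by rewrite mxE (negbTE ij) expr0n.
    by rewrite mxE !eqxx expr1n addr0.
  by rewrite mulr1 mulrC ler_pM2l// exprn_gt0// ltr0n.
have RE := restricted_eigenvalue M0 (divr_ge0 (ltW n1R) (ler0n _ 16)) h3 (fun j => ltW (h1 j)).
case: thP => bk _ _; case: bhatP => opt _.
exact: (lasso_error n10 p1 M0 s0 A0 A2 NM kl bk (opt z beta) (ltW h2) cols RE).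
Qed.

(** Since p >= 2, the number of events is at most 2 p^(2 M) <= 2 exp(n1 / 4). What remains of the
    union bound is 2 exp(- n1 / 4), and exp(n1 / 4) >= 1 + n1 / 4 >= 2 ln p. *)
Let prob_bad M (sg : 'S_(n1 + n2)) : (0 < M)%N -> 8 * lp * M%:R <= n1%:R ->
  (P ((fun t => subsample1 sg (Z t) : sampleType R n1 p) @^-1`
       (~` good_sample M beta sigma)) <= (lp^-1)%:E)%E.
Proof.
move=> M0 MN.
have h := @prob_not_good_sample R n1 p M beta sigma _ _ P _ Z (fun i => sg (lshift n2 i))
  (fun t => subsample1 sg (Z t)) s0 _ _ _ _ iidY.
apply: le_trans (h _ _ _ _) _.
- by move=> i j /perm_inj /lshift_inj.
- by move=> t i j; exact: subsample1_design.
- by move=> t i; exact: subsample1_response.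
- exact: measurableT_comp (measurable_subsample1 sg) mZ.
rewrite lee_fin.
have pM : (p + 1 + (p * 2) ^ M)%:R <= 2 * expR (n1%:R / 4) :> R.
  apply: (@le_trans _ _ (2 * (p ^ 2) ^ M)%:R).
    rewrite ler_nat mul2n -addnn leq_add//; last first.
      by rewrite leq_exp2r// -mulnn leq_mul2l p1 orbT.
    apply: (@leq_trans (p ^ 2)); last first.
      by rewrite -{1}(expn1 (p ^ 2)) leq_exp2l// -(exp1n 2) ltn_exp2r.
    rewrite -mulnn; apply: (@leq_trans (p * 2)); last by rewrite leq_mul2l p1 orbT.
    by rewrite muln2 -addnn leq_add2l ltnW.
  rewrite natrM ler_pM2l// -expnM natrX.
  have -> : (p%:R : R) = expR lp by rewrite lnK// posrE ltr0n ltnW.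
  rewrite -expRM_natl ler_expR natrM.
  move: MN; move: (M%:R : R) => m; lra.
apply: (@le_trans _ _ (2 * expR (n1%:R / 4) * expR (- (n1%:R / 2)))).
  by rewrite ler_wpM2r// expR_ge0.
rewrite -mulrA -expRD.
have -> : n1%:R / 4 + - (n1%:R / 2) = - (n1%:R / 4) :> R by field.
rewrite expRN -ler_pdivlMl// -invfM lef_pV2 ?posrE ?mulr_gt0 ?expR_gt0//.
have := expR_ge1Dx (n1%:R / 4 : R); have := lp_n1; lra.
Qed.

Let measurable_rss1 sg : measurable_fun setT
  (fun z : sampleType R (n1 + n2) p =>
     sqnorm (residual (subsample2 sg z) (bhat (subsample1 sg z)))).
Proof.
exact: (measurableT_comp (measurable_rss mbhat)
  (measurable_fun_pair (measurable_subsample1 sg) (measurable_subsample2 sg))).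
Qed.

Let measurable_psi sg : measurable_fun setT
  (fun z : sampleType R (n1 + n2) p => psi sigma bhat sg z).
Proof.
apply: measurable_minr; last exact: measurable_cst.
by apply: measurable_funM; [exact: measurable_rss1|exact: measurable_cst].
Qed.

Lemma psi_ge0 (sg : 'S_(n1 + n2)) (z : sample R (n1 + n2) p) : 0 <= psi sigma bhat sg z.
Proof.
rewrite /psi le_min divr_ge0 ?sqnorm_ge0//=.
by rewrite mulr_ge0 ?sqr_ge0// ltW.
Qed.

Lemma mean_psi (sg : 'S_(n1 + n2)) : (\int[P]_t (psi sigma bhat sg (Z t))%:E <=
  (mean_const * sigma ^+ 2)%:E)%E.
Proof.
have [M [M0 NM MN]] := sparsity_exists.
set G := @good_sample R n1 p M beta sigma.
have mG : measurable G by exact: measurable_good_sample.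
pose U t : sampleType R n1 p := subsample1 sg (Z t).
have mU : measurable_fun setT U by exact: measurableT_comp (measurable_subsample1 sg) mZ.
have H0 : 0 <= risk_const * sigma ^+ 2 by rewrite mulr_ge0// sqr_ge0.
(* Pointwise psi <= f + g: on the good event keep the residual branch of the minimum, outside it the
   cap. *)
pose f t := n2%:R^-1 * (\1_G (U t) * sqnorm (residual (subsample2 sg (Z t)) (bhat (U t)))).
pose g t := (sigma ^+ 2 * lp) * \1_(U @^-1` (~` G)) t.
have mUG : measurable (U @^-1` (~` G)).
  by rewrite -[X in measurable X]setTI; apply: mU => //; exact: measurableC.
have f0 t : 0 <= f t by rewrite mulr_ge0 ?invr_ge0// mulr_ge0 ?sqnorm_ge0.
have g0 t : 0 <= g t by rewrite mulr_ge0// mulr_ge0 ?sqr_ge0// ltW.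
have mf' : measurable_fun setT
    (fun t => \1_G (U t) * sqnorm (residual (subsample2 sg (Z t)) (bhat (U t)))).
  apply: measurable_funM; last exact: measurableT_comp (measurable_rss1 sg) mZ.
  by apply: measurableT_comp mU; exact: measurable_indic.
have mf : measurable_fun setT f by apply: measurable_funM => //; exact: measurable_cst.
have mg : measurable_fun setT g.
  by apply: measurable_funM; [exact: measurable_cst|exact: measurable_indic].
apply: (@le_trans _ _ (\int[P]_t ((f t)%:E + (g t)%:E))%E).
  apply: ge0_le_integral => //.
  - by move=> t _; rewrite lee_fin psi_ge0.
  - by apply/measurable_EFinP; exact: measurableT_comp (measurable_psi sg) mZ.
  - by apply: emeasurable_funD; exact/measurable_EFinP.
  - move=> t _; rewrite -EFinD lee_fin /f /g /psi !indicE -/(U t) -/lp.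
    have [tG|tG] := boolP (U t \in G).
      have -> : (t \in U @^-1` (~` G)) = false.
        by apply: memNset => /=; apply; exact: set_mem.
      by rewrite mulr0 addr0 mul1r ge_min mulrC lexx.
    have -> : (t \in U @^-1` (~` G)) = true.
      by apply: mem_set => /= h; move/negP: tG; apply; exact: mem_set.
    by rewrite mul0r mulr0 add0r mulr1 ge_min lexx orbT.
rewrite ge0_integralD//.
- have If : (\int[P]_x (f x)%:E <= ((risk_const + 1) * 6 * sigma ^+ 2)%:E)%E.
    rewrite /f; under eq_integral do rewrite EFinM.
    rewrite ge0_integralZl; [|by []|exact/measurable_EFinP| |]; last 2 first.
    + by move=> t _; rewrite lee_fin mulr_ge0 ?sqnorm_ge0.
    + by rewrite lee_fin invr_ge0.
    have := mean_rss_on sg s0 mZ mbhat iidY mG (fun z => @good_risk M z M0 NM) H0.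
    move=> /(@lee_wpmul2l _ (n2%:R^-1)%:E) => /(_ (_ : 0 <= _)%E).
    rewrite lee_fin invr_ge0 ler0n => /(_ isT) h.
    apply: le_trans h _; rewrite -EFinM lee_fin le_eqVlt; apply/orP; left; apply/eqP.
    by field; rewrite gt_eqF.
  have Ig : (\int[P]_x (g x)%:E <= (sigma ^+ 2)%:E)%E.
    rewrite /g; under eq_integral do rewrite EFinM.
    rewrite ge0_integralZl; [|by []|exact/measurable_EFinP/measurable_indic| |]; last 2 first.
    + by move=> t _; rewrite lee_fin.
    + by rewrite lee_fin mulr_ge0 ?sqr_ge0// ltW.
    rewrite integral_indic// setIT.
    have := @prob_bad M sg M0 MN.
    move=> /(@lee_wpmul2l _ (sigma ^+ 2 * lp)%:E) => /(_ (_ : 0 <= _)%E).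
    rewrite lee_fin mulr_ge0 ?sqr_ge0 ?(ltW lp0)// => /(_ isT) h.
    apply: le_trans h _; rewrite -EFinM lee_fin le_eqVlt; apply/orP; left; apply/eqP.
    by rewrite mulfK// gt_eqF.
  apply: le_trans (leeD If Ig) _; rewrite -EFinD lee_fin /mean_const.
  by rewrite [X in _ <= X]mulrDl mul1r.
- by move=> t _; rewrite lee_fin.
- exact/measurable_EFinP.
- by move=> t _; rewrite lee_fin.
- exact/measurable_EFinP.
Qed.

Variables (s : T -> 'S_(n1 + n2)) (alpha : R).
Hypothesis rs : random_split P Z s.
Hypothesis alpha01 : 0 < alpha < 1.

Let q1 := chi2_quantile (alpha / 2) n2.
Let q2 := chi2_quantile (1 - alpha / 2) n2.
Variables (B D : R).
Hypotheses (B0 : 0 < B) (D0 : 0 < D) (q1B : n2%:R / B <= q1) (q12 : q1 <= q2).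
Hypothesis q2D : q2 <= q1 + D * Num.sqrt n2%:R.
Hypothesis q1P : (chi2_prob n2 `]-oo, q1[ <= (alpha / 2)%:E)%E.
Hypothesis q2P : (chi2_prob n2 `]q2, +oo[ <= (alpha / 2)%:E)%E.

Let q10 : 0 < q1. Proof. by rewrite (lt_le_trans _ q1B)// divr_gt0. Qed.
Let q20 : 0 < q2. Proof. exact: lt_le_trans q12. Qed.

Let rss (sg : 'S_(n1 + n2)) (z : sample R (n1 + n2) p) : R :=
  sqnorm (residual (subsample2 sg z) (bhat (subsample1 sg z))).
Let risk (sg : 'S_(n1 + n2)) (z : sample R (n1 + n2) p) : R :=
  sqnorm (bhat (subsample1 sg z) - beta).

Let covered (sg : 'S_(n1 + n2)) : set (sampleType R (n1 + n2) p) :=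
  [set z | risk sg z \in CI1 sigma alpha bhat sg z].

Let mbound tau sg : measurable_fun setT
  (fun z : sampleType R (n1 + n2) p => CI_bound sigma bhat tau sg z).
Proof.
apply: measurable_maxr; last exact: measurable_cst.
apply: measurable_funB; last exact: measurable_cst.
by apply: measurable_funM; [exact: measurable_psi|exact: measurable_cst].
Qed.

Let mrisk sg : measurable_fun setT (fun z : sampleType R (n1 + n2) p => risk sg z).
Proof. exact: measurableT_comp (measurable_risk beta mbhat) (measurable_subsample1 sg). Qed.

Let measurable_le (f g : sampleType R (n1 + n2) p -> R) :
  measurable_fun setT f -> measurable_fun setT g -> measurable [set z | f z <= g z].
Proof.
move=> mf mg; have := measurable_funB mg mf measurableT (measurable_itv `[0, +oo[).
by congr measurable; apply/seteqP; split => z /=; rewrite in_itv/= andbT subr_ge0 => // -[].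
Qed.

Let measurable_covered sg : measurable (covered sg).
Proof.
have := measurableI _ _ (measurable_le (mbound (1 - alpha / 2) sg) (mrisk sg))
                        (measurable_le (mrisk sg) (mbound (alpha / 2) sg)).
congr measurable; apply/seteqP; split => z; rewrite /covered /CI1/= in_itv/=.
  by move=> [-> ->].
by move/andP.
Qed.

(** If the cap is inactive, n2 cancels and the endpoints are the positive parts of
    [rss / q - sigma^2]. Membership is then q1 <= [rss / (risk + sigma^2)] <= q2; the positive part
    is harmless since the risk is nonnegative. *)
Let uncoveredE sg z : ~ covered sg z ->
  [\/ rss sg z / (risk sg z + sigma ^+ 2) < q1,
      q2 < rss sg z / (risk sg z + sigma ^+ 2) |
      sigma ^+ 2 * lp <= psi sigma bhat sg z].
Proof.
apply: contra_notP => h.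
have v0 : 0 < risk sg z + sigma ^+ 2 by rewrite ltr_wpDl ?sqnorm_ge0// exprn_gt0.
have h1 : q1 <= rss sg z / (risk sg z + sigma ^+ 2).
  by rewrite leNgt; apply/negP => H; apply: h; exact: Or31.
have h2 : rss sg z / (risk sg z + sigma ^+ 2) <= q2.
  by rewrite leNgt; apply/negP => H; apply: h; exact: Or32.
have h3 : psi sigma bhat sg z < sigma ^+ 2 * lp.
  by rewrite ltNge; apply/negP => H; apply: h; exact: Or33.
have psiE : psi sigma bhat sg z = rss sg z / n2%:R.
  move: h3; rewrite /psi gt_min -/lp ltxx orbF => h3.
  by apply/min_idPl; exact: ltW.
have E q : 0 < q -> psi sigma bhat sg z / (n2%:R^-1 * q) = rss sg z / q.
  by move=> q0; rewrite psiE; field; rewrite !gt_eqF.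
rewrite /covered /CI1/= in_itv/= /CI_bound -/q1 -/q2 !E//.
rewrite ge_max le_max sqnorm_ge0 andbT lerBlDr lerBrDr.
rewrite ler_pdivrMr// ler_pdivlMr//.
move: h1 h2; rewrite ler_pdivlMr// ler_pdivrMr// => h1 h2.
by rewrite mulrC h2/= mulrC h1.
Qed.

Let prob_covered sg :
  ((1 - alpha - mean_const / lp)%:E <= P (Z @^-1` covered sg))%E.
Proof.
pose W t := rss sg (Z t) / (risk sg (Z t) + sigma ^+ 2).
have mcomp (X : set (sampleType R (n1 + n2) p)) : measurable X -> measurable (Z @^-1` X).
  by move=> mX; rewrite -[X in measurable X]setTI; exact: mZ.
have mC := mcomp _ (measurable_covered sg).
have mW : measurable_fun setT W.
  apply: measurable_funM; first exact: measurableT_comp (measurable_rss1 sg) mZ.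
  apply: measurable_fun_invr.
    apply: measurable_funD; last exact: measurable_cst.
    exact: measurableT_comp (mrisk sg) mZ.
  by move=> t; rewrite addr_ge0 ?sqnorm_ge0// sqr_ge0.
pose A1 := W @^-1` `]-oo, q1[; pose A2' := W @^-1` `]q2, +oo[.
pose A3 := Z @^-1` [set z | sigma ^+ 2 * lp <= psi sigma bhat sg z].
have mA1 : measurable A1 by rewrite -[A1]setTI; exact: mW.
have mA2 : measurable A2' by rewrite -[A2']setTI; exact: mW.
have mA3 : measurable A3.
  apply: mcomp; apply: measurable_le; [exact: measurable_cst|exact: measurable_psi].
have PA1 : (P A1 <= (alpha / 2)%:E)%E.
  apply: le_trans q1P; rewrite -(normalized_rss_law sg s0 mZ mbhat iidY (measurable_itv _)).
  exact: lexx.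
have PA2 : (P A2' <= (alpha / 2)%:E)%E.
  apply: le_trans q2P; rewrite -(normalized_rss_law sg s0 mZ mbhat iidY (measurable_itv _)).
  exact: lexx.
have slp : 0 < sigma ^+ 2 * lp by rewrite mulr_gt0// exprn_gt0.
have PA3 : (P A3 <= (mean_const / lp)%:E)%E.
  (* Markov's inequality for psi at the level of its cap. *)
  have h : ((sigma ^+ 2 * lp)%:E * P A3 <= (mean_const * sigma ^+ 2)%:E)%E.
    apply: le_trans (mean_psi sg).
    rewrite -[X in (_ * P X)%E]setIT -(integral_indic P measurableT mA3).
    rewrite -ge0_integralZl; [|by []|exact/measurable_EFinP/measurable_indic|
      by move=> t _; rewrite lee_fin|by rewrite lee_fin ltW].
    apply: ge0_le_integral => //.
    - by move=> t _; rewrite lee_fin mulr_ge0// ltW.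
    - by apply/measurable_EFinP; apply: measurable_funM; [exact: measurable_cst|exact: measurable_indic].
    - by apply/measurable_EFinP; exact: measurableT_comp (measurable_psi sg) mZ.
    - move=> t _; rewrite -EFinM lee_fin indicE.
      have [tA|tA] := boolP (t \in A3); last by rewrite mulr0 psi_ge0.
      by rewrite mulr1; move: tA; rewrite inE.
  rewrite -(fineK (fin_num_measure P A3 mA3)) -EFinM !lee_fin in h *.
  rewrite ler_pdivlMr// -(ler_pM2r (exprn_gt0 2 s0)); apply: le_trans h.
  by rewrite le_eqVlt; apply/orP; left; apply/eqP; ring.
have PC : (P (~` (Z @^-1` covered sg)) <= (alpha / 2)%:E + (alpha / 2)%:E + (mean_const / lp)%:E)%E.
  apply: (@le_trans _ _ (P (A1 `|` A2' `|` A3))).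
    apply: le_measure; rewrite ?inE.
    - exact: measurableC.
    - by apply: measurableU => //; exact: measurableU.
    - by move=> t /uncoveredE [h|h|h]; [left; left|left; right|right];
        rewrite /A1 /A2' /A3/= ?in_itv/= ?andbT.
  have h12 : (P (A1 `|` A2') <= P A1 + P A2')%E by exact: measureU2.
  have h3 : (P (A1 `|` A2' `|` A3) <= P (A1 `|` A2') + P A3)%E.
    by apply: measureU2 => //; exact: measurableU.
  apply: le_trans h3 _; apply: leeD PA3; apply: le_trans h12 _; exact: leeD.
rewrite probability_setC// in PC.
move: PC; rewrite -(fineK (fin_num_measure P _ mC)) -EFinB -!EFinD !lee_fin; lra.
Qed.

Lemma coverage_ge : ((1 - alpha - mean_const / lp)%:E <=
  P [set t | sqnorm (bhat (subsample1 (s t) (Z t)) - beta) \in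
             CI1 sigma alpha bhat (s t) (Z t)])%E.
Proof.
set E := [set t | _].
(* Splitting by the value of the permutation proves measurability of the coverage event. *)
have EE : E = \bigcup_(sg : 'S_(n1 + n2)) (s @^-1` [set sg] `&` Z @^-1` covered sg).
  apply/seteqP; split => t.
    by move=> h; exists (s t).
  by move=> [sg _ [/= <- h]].
have mE : measurable E.
  rewrite EE; apply: fin_bigcup_measurable => [|sg _]; first exact: finite_finset.
  apply: measurableI.
    by have [] := rs sg.
  by rewrite -[X in measurable X]setTI; apply: mZ => //; exact: measurable_covered.
rewrite -[X in P X]setIT -(integral_indic P measurableT mE).
apply: (@split_average_ge _ _ _ P _ _ Z s mZ rs (fun sg => \1_(covered sg))) => //.
move=> sg; apply: le_trans (prob_covered sg) _.
have mC : measurable (Z @^-1` covered sg).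
  by rewrite -[X in measurable X]setTI; apply: mZ => //; exact: measurable_covered.
by rewrite -[X in P X]setIT -(integral_indic P measurableT mC).
Qed.

Let bound_le (sg : 'S_(n1 + n2)) (z : sample R (n1 + n2) p) :
  CI_bound sigma bhat (1 - alpha / 2) sg z <= CI_bound sigma bhat (alpha / 2) sg z.
Proof.
rewrite /CI_bound -/q1 -/q2 ge_max !le_max lexx orbT andbT; apply/orP; left.
rewrite lerD2r ler_wpM2l ?psi_ge0// lef_pV2 ?posrE ?mulr_gt0 ?invr_gt0//.
by rewrite ler_pM2l ?invr_gt0.
Qed.

(** The positive part is 1-Lipschitz, so sigma^2 drops out. Then n2 / q1 - n2 / q2 = (q2 - q1) n2 /
    (q1 q2), with q2 - q1 <= D sqrt n2 and both quantiles at least n2 / B. *)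
Let bound_diff (sg : 'S_(n1 + n2)) (z : sample R (n1 + n2) p) :
  CI_bound sigma bhat (alpha / 2) sg z - CI_bound sigma bhat (1 - alpha / 2) sg z <=
  D * B ^+ 2 / Num.sqrt n2%:R * psi sigma bhat sg z.
Proof.
rewrite /CI_bound -/q1 -/q2; set ps := psi sigma bhat sg z.
have ps0 : 0 <= ps by exact: psi_ge0.
set r := Num.sqrt n2%:R.
have r0 : 0 < r by rewrite sqrtr_gt0.
have rr : r ^+ 2 = n2%:R by rewrite sqr_sqrtr// ltW.
have max_diff (x y : R) : y <= x -> Num.max x 0 - Num.max y 0 <= x - y.
  by move=> yx; case: (leP x 0) => hx; case: (leP y 0) => hy; lra.
have inv : n2%:R / q1 - n2%:R / q2 <= D * B ^+ 2 / r.
  have -> : n2%:R / q1 - n2%:R / q2 = (q2 - q1) * n2%:R / (q1 * q2).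
    by field; rewrite !gt_eqF.
  rewrite ler_pdivrMr ?mulr_gt0//.
  apply: (@le_trans _ _ (D * r * n2%:R)).
    by rewrite ler_pM2r// lerBlDl.
  have nB0 : 0 <= n2%:R / B by rewrite divr_ge0// ltW.
  apply: (@le_trans _ _ (D * B ^+ 2 / r * ((n2%:R / B) * (n2%:R / B)))).
    rewrite le_eqVlt; apply/orP; left; apply/eqP; rewrite -rr; field.
    by rewrite !gt_eqF.
  apply: ler_wpM2l; first by rewrite divr_ge0 ?(ltW r0)// mulr_ge0 ?sqr_ge0// ltW.
  by apply: ler_pM => //; exact: le_trans q12.
apply: le_trans (max_diff _ _ _) _.
  rewrite lerD2r ler_wpM2l// lef_pV2 ?posrE ?mulr_gt0 ?invr_gt0//.
  by rewrite ler_pM2l ?invr_gt0.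
have -> : ps / (n2%:R^-1 * q1) - sigma ^+ 2 - (ps / (n2%:R^-1 * q2) - sigma ^+ 2) =
  (n2%:R / q1 - n2%:R / q2) * ps by field; rewrite !gt_eqF.
by rewrite ler_wpM2r.
Qed.

Lemma length_le :
  (\int[P]_t lebesgue_measure [set` CI1 sigma alpha bhat (s t) (Z t)] <=
   (D * B ^+ 2 / Num.sqrt n2%:R * (mean_const * sigma ^+ 2))%:E)%E.
Proof.
pose f (sg : 'S_(n1 + n2)) (z : sampleType R (n1 + n2) p) :=
  CI_bound sigma bhat (alpha / 2) sg z - CI_bound sigma bhat (1 - alpha / 2) sg z.
have f0 sg z : 0 <= f sg z by rewrite subr_ge0.
have mf sg : measurable_fun setT (f sg) by apply: measurable_funB; exact: mbound.
rewrite [leLHS](_ : _ = \int[P]_t (f (s t) (Z t))%:E)%E; last first.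
  apply: eq_integral => t _; rewrite /CI1 lebesgue_measure_itv/= lte_fin.
  (* Without a strict inequality the interval has measure 0; by [bound_le] its endpoints then
     coincide, so [f] vanishes too. *)
  case: ltP => [_|h]; first by rewrite -EFinB.
  by rewrite /f (_ : CI_bound sigma bhat (alpha / 2) (s t) (Z t) =
    CI_bound sigma bhat (1 - alpha / 2) (s t) (Z t)) ?subrr//; apply/le_anti; rewrite h bound_le.
apply: (split_average_le mZ rs mf f0) => sg.
set c := D * B ^+ 2 / _.
have c0 : 0 <= c by rewrite divr_ge0 ?sqrtr_ge0// mulr_ge0 ?sqr_ge0// ltW.
have mpsi : measurable_fun setT (fun t => (psi sigma bhat sg (Z t))%:E).
  by apply/measurable_EFinP; exact: measurableT_comp (measurable_psi sg) mZ.
apply: (@le_trans _ _ (\int[P]_t (c%:E * (psi sigma bhat sg (Z t))%:E))%E).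
  apply: ge0_le_integral => //.
  - by move=> t _; rewrite lee_fin.
  - by apply/measurable_EFinP; exact: measurableT_comp (mf sg) mZ.
  - by apply: emeasurable_funM => //; exact: measurable_cst.
  - by move=> t _; rewrite -EFinM lee_fin; exact: bound_diff.
rewrite ge0_integralZl//.
- by rewrite [leRHS]EFinM lee_wpmul2l ?lee_fin// mean_psi.
- by move=> t _; rewrite lee_fin psi_ge0.
Qed.

End fixed_dimension.

(** * The asymptotic statement *)

Lemma limn_einf_ge (R : realType) (u : (\bar R)^nat) (x : \bar R) :
  (\forall n \near \oo, (x <= u n)%E) -> (x <= limn_einf u)%E.
Proof.
move=> [N _ xu]; rewrite limn_einf_lim; apply: lime_ge; first exact: is_cvg_einfs.
exists N => // n /= Nn; apply: le_ereal_inf_tmp => _ [m /= nm <-].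
by apply: xu; exact: leq_trans nm.
Qed.

(** K expresses that n1 and n2 are of the same order. The sparsity condition is read as k <= c n /
    ln p with c small, depending on K alone; C depends on K, A and alpha, but on neither sigma0 nor
    the sequences. The length bound holds at every index, not only in the limit. *)
Theorem proposition2 (R : realType) (K : R) (K_gt0 : 0 < K) :
  exists c : R, 0 < c /\
  forall (A alpha : R), Num.sqrt 2 < A -> 0 < alpha < 1 ->
  exists C : R, 0 < C /\
  forall (sigma0 : R) (n1 n2 p k : nat -> nat),
    0 < sigma0 ->
    (forall m, (0 < n1 m)%N /\ (0 < n2 m)%N) ->
    (forall m, (n1 m)%:R <= K * (n2 m)%:R /\ (n2 m)%:R <= K * (n1 m)%:R) ->
    (forall m, (1 < p m)%N /\ (0 < k m)%N) ->
    (forall m, (k m)%:R <= c * ((n1 m + n2 m)%:R / ln (p m)%:R)) ->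
    (fun m => n1 m + n2 m)%N @ \oo --> \oo ->
    p @ \oo --> \oo ->
  forall (d : nat -> measure_display) (T : forall m, measurableType (d m))
    (P : forall m, param R (p m) -> probability (T m) R)
    (Z : forall m, T m -> sample R (n1 m + n2 m) (p m))
    (s : forall m, T m -> 'S_(n1 m + n2 m))
    (bhat : forall m, sample R (n1 m) (p m) -> 'cV[R]_(p m)),
    (forall m th, Theta0 sigma0 (k m) th ->
       linear_model (P m th) th (Z m) /\ random_split (P m th) (Z m) (s m)) ->
    (forall m, lasso_estimator A sigma0 (bhat m)) ->
  ((1 - alpha)%:E <= limn_einf (fun m =>
     ereal_inf [set coverage sigma0 alpha (bhat m) (P m) (Z m) (s m) th
               | th in Theta0 sigma0 (k m)]))%E /\
  (forall m,
     ereal_sup [set expected_length sigma0 alpha (bhat m) (P m) (Z m) (s m) th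
               | th in Theta0 sigma0 (k m)]
     <= (C * ((Num.sqrt (n1 m + n2 m)%:R)^-1 * sigma0 ^+ 2))%:E)%E.
Proof.
have K1 : 0 < 1 + K by rewrite addr_gt0.
have [L L0 LE] : exists2 L : R, 0 < L & L = 1024 * 2048.
  by exists (1024 * 2048) => [|//]; exact: mulr_gt0 (ltr0Sn _ _) (ltr0Sn _ _).
(* The factor 1 + K converts n1 + n2 into n1, and L is the constant demanded by [lasso_error]. *)
exists (L * (1 + K))^-1; split; first by rewrite invr_gt0 mulr_gt0.
move=> A alpha A2 alpha01.
have sqrt2 : 0 < Num.sqrt 2 :> R by rewrite sqrtr_gt0.
have A0 : 0 < A := lt_trans sqrt2 A2.
have {A2} A2 : 2 <= A ^+ 2.
  rewrite -[X in X <= _](sqr_sqrtr (ler0n R 2)).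
  by apply: lerXn2r (ltW A2); rewrite nnegrE ltW.
have /andP[a0 a1] := alpha01.
have [|B [D [B0 [D0 hq]]]] := @chi2_quantile_bounds R (alpha / 2); first by apply/andP; split; lra.
have mc0 : 0 < mean_const A.
  rewrite /mean_const ltr_wpDl// mulr_ge0// addr_ge0//.
  exact: mulr_ge0 (ler0n _ _) (addr_ge0 (mulr_ge0 (ler0n _ _) (ler0n _ _)) (sqr_ge0 _)).
exists (D * B ^+ 2 * mean_const A * Num.sqrt (1 + K)); split.
  by rewrite !mulr_gt0 ?sqrtr_gt0// exprn_gt0.
move=> sigma0 n1 n2 p k s0 n0 nK pk kc _ poo d T P Z s bhat model lasso.
have lp0 m : 0 < ln (p m)%:R :> R by have [p1 _] := pk m; rewrite ln_gt0// ltr1n.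
have kl m : 1024 * (2048 * ((k m)%:R * ln (p m)%:R)) <= (n1 m)%:R :> R.
  have := kc m; rewrite [_ * (_ / _)]mulrA ler_pdivlMr// => h.
  have {h} h : L * (1 + K) * ((k m)%:R * ln (p m)%:R) <= (n1 m + n2 m)%:R.
    rewrite -ler_pdivlMl ?mulr_gt0//; exact: h.
  have [_ nK2] := nK m.
  have {}h : L * (1 + K) * ((k m)%:R * ln (p m)%:R) <= (1 + K) * (n1 m)%:R.
    by apply: le_trans h _; rewrite natrD mulrDl mul1r lerD2l.
  by rewrite mulrA -LE; move: h; rewrite mulrAC mulrC ler_pM2l.
split.
  apply/lee_subgt0Pr => e e0; apply: limn_einf_ge.
  (* Beyond this threshold ln p >= [mean_const A / e], so the loss [mean_const A / ln p] in coverage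
     is at most e. *)
  move/cvgnyPge : poo => /(_ (Num.truncn (expR (mean_const A / e))).+1).
  apply: filterS => m hm.
  apply: le_ereal_inf_tmp => _ [th thT <-].
  have [[n10 n20] [p1 k0]] := (n0 m, pk m).
  have [lm rs] := model m th thT.
  have [q1B q12 q2D q1P q2P] := hq _ n20.
  have h : ((1 - alpha - mean_const A / ln (p m)%:R)%:E <=
      coverage sigma0 alpha (bhat m) (P m) (Z m) (s m) th)%E.
    exact: (coverage_ge n10 n20 p1 k0 s0 A0 A2 (kl m) thT lm (lasso m) rs B0 q1B q12 q1P q2P).
  apply: le_trans h; rewrite -EFinB lee_fin lerD2l lerN2 ler_pdivrMr// mulrC -ler_pdivrMr//.
  have p0 : 0 < (p m)%:R :> R by rewrite ltr0n ltnW.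
  rewrite -ler_expR lnK ?posrE//.
  have := Num.Theory.truncn_itv (expR_ge0 (mean_const A / e)) => /andP[_ /ltW h].
  by apply: le_trans h _; rewrite ler_nat.
move=> m; apply: ge_ereal_sup => _ [th thT <-].
have [[n10 n20] [p1 k0]] := (n0 m, pk m).
have [lm rs] := model m th thT.
have [q1B q12 q2D q1P q2P] := hq _ n20.
have h : (expected_length sigma0 alpha (bhat m) (P m) (Z m) (s m) th <=
    (D * B ^+ 2 / Num.sqrt (n2 m)%:R * (mean_const A * sigma0 ^+ 2))%:E)%E.
  exact: (length_le n10 n20 p1 k0 s0 A0 A2 (kl m) thT lm (lasso m) rs B0 D0 q1B q12 q2D).
apply: le_trans h _; rewrite lee_fin.
have n2R : 0 < (n2 m)%:R :> R by rewrite ltr0n.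
have nR : 0 < (n1 m + n2 m)%:R :> R by rewrite ltr0n addn_gt0 n10.
(* The rate in n2 becomes a rate in n because n1 + n2 <= (1 + K) n2. *)
have E : (Num.sqrt (n2 m)%:R)^-1 <= Num.sqrt (1 + K) * (Num.sqrt (n1 m + n2 m)%:R)^-1.
  rewrite ler_pdivlMr ?sqrtr_gt0// mulrC ler_pdivrMr ?sqrtr_gt0// -sqrtrM ?(ltW K1)//.
  rewrite ler_wsqrtr// natrD mulrDl mul1r addrC lerD2l.
  by have [] := nK m.
have c0 : 0 <= D * B ^+ 2 * (mean_const A * sigma0 ^+ 2).
  by rewrite mulr_ge0 ?mulr_ge0 ?sqr_ge0// ltW.
have := ler_wpM2l c0 E; congr (_ <= _); ring.
Qed.
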